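(* ($\mathsf{ZF}$) For all strictly amorphous sets $A$ and all natural numbers $n$, $\mathrm{fin}(A)^n$ is dually Dedekind finite, and consequently $\mathscr{P}(A)^n$ is dually Dedekind finite.
   Context: The result is a theorem of $\mathsf{ZF}$, Zermelo--Fraenkel set theory without the axiom of choice. A set is finite if it is equinumerous with some natural number, and infinite otherwise. An amorphous set is an infinite set that cannot be partitioned into two infinite subsets. A strictly amorphous set is an amorphous set in which every partition has only finitely many non-singleton blocks. A set $X$ is dually Dedekind finite if every surjection from $X$ onto $X$ is injective; otherwise $X$ is dually Dedekind infinite. $\mathscr{P}(A)$ denotes the power set of $A$, $\mathrm{fin}(A)$ denotes the set of all finite subsets of $A$, and $X^n$ denotes the $n$-fold Cartesian power of $X$. *)

(* Defs.v *)
(* The theorem is about ZF without choice.  Types and functions of Rocq cannot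
   play the role of sets here: under the usual choice axioms of the metatheory
   there is no amorphous type.  Hence we work inside an arbitrary model of
   first-order ZF.  The separation and replacement schemes range over formulas
   of the language {=, mem} with parameters, not over all predicates of Rocq,
   since the second-order schemes would let choice leak into the model. *)

Set Implicit Arguments.
Unset Strict Implicit.
Unset Printing Implicit Defensive.

(* De Bruijn indices: under a quantifier, variable 0 is the bound one. *)
Inductive formula : Type :=
| FMem (i j : nat)
| FEq (i j : nat)
| FFalse
| FImp (p q : formula)
| FAnd (p q : formula)
| FOr (p q : formula)
| FAll (p : formula)
| FEx (p : formula).

Definition scons (V : Type) (x : V) (s : nat -> V) (i : nat) : V :=
  match i with O => x | S j => s j end.

Fixpoint sat (V : Type) (mem : V -> V -> Prop) (s : nat -> V) (p : formula)
  : Prop :=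
  match p with
  | FMem i j => mem (s i) (s j)
  | FEq i j => s i = s j
  | FFalse => False
  | FImp p q => sat mem s p -> sat mem s q
  | FAnd p q => sat mem s p /\ sat mem s q
  | FOr p q => sat mem s p \/ sat mem s q
  | FAll p => forall x : V, sat mem (scons x s) p
  | FEx p => exists x : V, sat mem (scons x s) p
  end.

Record zf_model : Type := ZFModel {
  carrier :> Type;
  mem : carrier -> carrier -> Prop;
  zf_extensionality : forall a b : carrier,
    (forall x, mem x a <-> mem x b) -> a = b;
  zf_foundation : forall a : carrier,
    (exists x, mem x a) ->
    exists x, mem x a /\ ~ (exists y, mem y x /\ mem y a);
  zf_pairing : forall a b : carrier,
    exists c, forall x, mem x c <-> x = a \/ x = b;
  zf_union : forall a : carrier,
    exists u, forall x, mem x u <-> exists y, mem y a /\ mem x y;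
  zf_powerset : forall a : carrier,
    exists p, forall x, mem x p <-> (forall z, mem z x -> mem z a);
  zf_infinity : exists w : carrier,
    (exists e, (forall z, ~ mem z e) /\ mem e w) /\
    (forall x, mem x w ->
       exists y, (forall z, mem z y <-> mem z x \/ z = x) /\ mem y w);
  zf_separation : forall (p : formula) (s : nat -> carrier) (a : carrier),
    exists b, forall x, mem x b <-> mem x a /\ sat mem (scons x s) p;
  (* variable 0 is the value, variable 1 the argument *)
  zf_replacement : forall (p : formula) (s : nat -> carrier) (a : carrier),
    (forall x, mem x a -> forall y y',
       sat mem (scons y (scons x s)) p ->
       sat mem (scons y' (scons x s)) p -> y = y') ->
    exists b, forall y,
      mem y b <-> exists x, mem x a /\ sat mem (scons y (scons x s)) p
}.

Declare Scope zf_scope.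
Delimit Scope zf_scope with zf.
Notation "x ∈ y" := (mem x y) (at level 70, no associativity) : zf_scope.
Local Open Scope zf_scope.

(* All quantifiers below range over the elements of the model. *)
Section InModel.

Variable M : zf_model.
Implicit Types (A B C F N P X Y a b c e f n p x y z : M).

Definition subset x y : Prop := forall z, z ∈ x -> z ∈ y.

Definition is_empty e : Prop := forall z, ~ z ∈ e.

Definition is_succ y x : Prop := forall z, z ∈ y <-> z ∈ x \/ z = x.

Definition inductive_set x : Prop :=
  (exists e, is_empty e /\ e ∈ x) /\
  (forall y, y ∈ x -> exists z, is_succ z y /\ z ∈ x).

(* von Neumann natural numbers of the model, possibly nonstandard *)
Definition natural n : Prop := forall x, inductive_set x -> n ∈ x.

Definition is_upair p a b : Prop := forall z, z ∈ p <-> z = a \/ z = b.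

(* p = {{a}, {a, b}} *)
Definition is_pair p a b : Prop :=
  forall z, z ∈ p <-> is_upair z a a \/ is_upair z a b.

Definition maps f a b : Prop := exists p, is_pair p a b /\ p ∈ f.

Definition is_function f A B : Prop :=
  (forall p, p ∈ f -> exists a b, a ∈ A /\ b ∈ B /\ is_pair p a b) /\
  (forall a, a ∈ A -> exists! b, maps f a b).

Definition injective f : Prop :=
  forall a a' b, maps f a b -> maps f a' b -> a = a'.

Definition surjective f B : Prop :=
  forall b, b ∈ B -> exists a, maps f a b.

Definition equinumerous A B : Prop :=
  exists f, is_function f A B /\ injective f /\ surjective f B.

Definition finite A : Prop := exists n, natural n /\ equinumerous A n.

Definition infinite A : Prop := ~ finite A.

Definition amorphous A : Prop :=
  infinite A /\
  ~ (exists B C, (forall x, x ∈ A <-> x ∈ B \/ x ∈ C) /\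
                 ~ (exists x, x ∈ B /\ x ∈ C) /\
                 infinite B /\ infinite C).

Definition is_partition P A : Prop :=
  (forall b, b ∈ P -> subset b A /\ ~ is_empty b) /\
  (forall a, a ∈ A -> exists b, b ∈ P /\ a ∈ b) /\
  (forall b c, b ∈ P -> c ∈ P -> (exists a, a ∈ b /\ a ∈ c) -> b = c).

Definition is_singleton b : Prop := exists a, forall z, z ∈ b <-> z = a.

Definition strictly_amorphous A : Prop :=
  amorphous A /\
  forall P, is_partition P A ->
    exists N, (forall b, b ∈ N <-> b ∈ P /\ ~ is_singleton b) /\ finite N.

Definition dually_dedekind_finite X : Prop :=
  forall f, is_function f X X -> surjective f X -> injective f.

Definition is_powerset P A : Prop := forall x, x ∈ P <-> subset x A.

Definition is_fin F A : Prop := forall x, x ∈ F <-> subset x A /\ finite x.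

(* Y = X^n, the set of all functions from n = {0, ..., n-1} to X *)
Definition is_cartesian_power Y X n : Prop :=
  forall f, f ∈ Y <-> is_function f n X.

End InModel.

(* Main.v *)
Require Import Defs.
From Stdlib Require Import Classical ClassicalEpsilon PeanoNat Lia.

Set Implicit Arguments.
Unset Strict Implicit.
Unset Printing Implicit Defensive.

Local Open Scope zf_scope.

(** Since [fin(A)^n] is a subset of [P(A)^n], and a surjection of a subset onto itself
    extends by the identity, only [P(A)^n] needs an argument
    ([dually_finite_subset]). An element [x] of [P(A)^n] is read as a colouring of [A]: the
    colour of a point [a] is the set of the [i] in [n] with [a] in [x(i)]. There are finitely
    many colours, so all but finitely many points have one and the same colour. The kernel
    of [x] is the equivalence relation of having the same colour.

    A strictly amorphous set carries no structure beyond equality and finitely many named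
    points. This is used in the form of [kernel_coarsened]: for every map [F] on colourings
    there is one finite set [e] such that, outside [e], points of the same colour in [x]
    have the same colour in [F(x)]. It is reached in four steps.
    - A chain of finite subsets of [A] has finite union ([chain_union]). Otherwise its
      members would order an infinite part of [A] like the natural numbers, and the even and
      the odd positions would split [A].
    - A relation on [A] under which every point has finitely many successors has, apart
      from loops, finitely many successors altogether ([locally_finite_image]). For a
      symmetric relation the connected components are unions of chains of finite balls,
      hence finite, and strict amorphousness leaves only finitely many of them with more
      than one point.
    - By induction on the size of a finite set, the same holds if finite sets rather than
      points have finitely many successors ([closure_trivial]): algebraic closure is
      trivial.
    - Hence a definable property of a fresh point that depends on finitely many
      parameters has the same truth value at all fresh points ([generic_constancy]). If
      [a] and [b] share a colour in [x], three applications with a third fresh point [c]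
      exchange the roles of [a] and [b].

    It remains to see that a surjection [F] that makes kernels outside [e] coarser is
    injective. A kernel has a bounded number of blocks. A finite set [T] separated by some
    [x] but not by [F(x)], and maximal with this property, is a full set of
    representatives for the kernel of [x]. By maximality every preimage of a colouring
    with this kernel has this kernel too. There are only finitely many such colourings, and
    by surjectivity [F] must then map them onto themselves, so [F(x)] separates [T], a
    contradiction ([no_failing]). So [F] preserves kernels, and on each of the finite sets
    of colourings with a given kernel it is surjective, hence injective.

    All this has to happen inside the model. Finiteness is that of the model, whose
    natural numbers may be nonstandard, so induction is available for definable predicates
    only, and every set that is formed comes with a proof of definability. *)

(** * Definability with parameters *)

Fixpoint rename (r : nat -> nat) (p : formula) : formula :=
  let up r := fun i => match i with O => O | S j => S (r j) end in
  match p with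
  | FMem i j => FMem (r i) (r j)
  | FEq i j => FEq (r i) (r j)
  | FFalse => FFalse
  | FImp p q => FImp (rename r p) (rename r q)
  | FAnd p q => FAnd (rename r p) (rename r q)
  | FOr p q => FOr (rename r p) (rename r q)
  | FAll p => FAll (rename (up r) p)
  | FEx p => FEx (rename (up r) p)
  end.

Lemma sat_rename (V : Type) (m : V -> V -> Prop) p : forall r s s',
  (forall i, s' i = s (r i)) -> (sat m s (rename r p) <-> sat m s' p).
Proof.
  induction p as [i j|i j| |p IHp q IHq|p IHp q IHq|p IHp q IHq|p IHp|p IHp];
    intros r s s' H; simpl.
  1,2: rewrite !H; tauto.
  1: tauto.
  1,2,3: rewrite (IHp _ _ _ H), (IHq _ _ _ H); tauto.
  all: assert (K : forall x, sat m (scons x s)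
      (rename (fun i => match i with O => O | S j => S (r j) end) p)
      <-> sat m (scons x s') p)
    by (intro x; apply IHp; intros [|i]; simpl; auto).
  - split; intros G x; apply K, G.
  - split; intros [x G]; exists x; apply K, G.
Qed.

Arguments sat_rename {V m p r s} s' _.

Section Definability.

Context {M : zf_model}.

Definition tl (s : nat -> M) : nat -> M := fun i => s (S i).

(** Both the variables [s] and the parameters [t] are infinite sequences. Interleaving them
    keeps them apart without a bound on the number of variables, and two sequences of
    parameters can be merged in the same way. *)
Definition mix (s t : nat -> M) (i : nat) : M :=
  if Nat.even i then s (Nat.div2 i) else t (Nat.div2 i).

(** Relations of any arity are predicates of the whole assignment [s]; the bound variable
    of a quantifier is [s 0], and [tl s] is what remains. *)
Definition definable (P : (nat -> M) -> Prop) : Prop :=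
  exists p t, forall s, P s <-> sat (@mem M) (mix s t) p.

Definition definable_term (t : (nat -> M) -> M) : Prop := definable (fun s => s 0 = t (tl s)).

Definition definable1 (P : M -> Prop) := definable (fun s => P (s 0)).
Definition definable2 (P : M -> M -> Prop) := definable (fun s => P (s 0) (s 1)).
Definition definable3 (P : M -> M -> M -> Prop) := definable (fun s => P (s 0) (s 1) (s 2)).
Definition definable_fun1 (f : M -> M) := definable_term (fun s => f (s 0)).
Definition definable_fun2 (f : M -> M -> M) := definable_term (fun s => f (s 0) (s 1)).

Lemma mix_even s t i : mix s t (2 * i) = s i.
Proof.
  unfold mix. rewrite Nat.even_mul. cbn [Nat.even orb].
  f_equal. rewrite Nat.div2_double. reflexivity.
Qed.

Lemma mix_odd s t i : mix s t (S (2 * i)) = t i.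
Proof.
  unfold mix. rewrite Nat.even_succ, Nat.odd_mul. cbn [Nat.odd negb Nat.even andb].
  f_equal. rewrite Nat.div2_succ_double. reflexivity.
Qed.

Lemma definable_ext P Q : (forall s, P s <-> Q s) -> definable P -> definable Q.
Proof.
  intros H (p & t & K). exists p, t. intro s. rewrite <- H. apply K.
Qed.

Lemma even_or_odd i : exists j, i = 2 * j \/ i = S (2 * j).
Proof.
  destruct (Nat.Even_or_Odd i) as [[j ->]|[j ->]]; exists j; lia.
Qed.

(** Variables sit at even places and parameters at odd places, so the two can be renamed
    independently; this is what lets two formulas share one sequence of parameters. *)
Lemma mix_rename (r q : nat -> nat) : exists f : nat -> nat,
  (forall i, f (2 * i) = 2 * r i) /\ (forall i, f (S (2 * i)) = S (2 * q i)).
Proof.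
  exists (fun i => if Nat.even i then 2 * r (Nat.div2 i) else S (2 * q (Nat.div2 i))).
  split; intro i.
  - rewrite Nat.even_mul, Nat.div2_double. reflexivity.
  - rewrite Nat.even_succ, Nat.odd_mul, Nat.div2_succ_double. reflexivity.
Qed.

Lemma definable_rename P (r : nat -> nat) :
  definable P -> definable (fun s => P (fun i => s (r i))).
Proof.
  intros (p & t & K).
  destruct (mix_rename r (fun i => i)) as (f & f0 & f1).
  exists (rename f p), t. intro s. rewrite K. symmetry. apply sat_rename.
  intro i. destruct (even_or_odd i) as [j [-> | ->]].
  - rewrite f0, !mix_even. reflexivity.
  - rewrite f1, !mix_odd. reflexivity.
Qed.

Lemma definable_bin (op : formula -> formula -> formula) (OP : Prop -> Prop -> Prop) P Q :
  (forall p q s, sat (@mem M) s (op p q)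
     <-> OP (sat (@mem M) s p) (sat (@mem M) s q)) ->
  (forall A B C D, (A <-> B) -> (C <-> D) -> (OP A C <-> OP B D)) ->
  definable P -> definable Q -> definable (fun s => OP (P s) (Q s)).
Proof.
  intros H E (p & t & K) (q & u & L).
  destruct (mix_rename (fun i => i) (fun i => 2 * i)) as (f & f0 & f1).
  destruct (mix_rename (fun i => i) (fun i => S (2 * i))) as (g & g0 & g1).
  exists (op (rename f p) (rename g q)), (mix t u). intro s.
  rewrite H. apply E.
  - rewrite K. symmetry. apply sat_rename.
    intro i. destruct (even_or_odd i) as [j [-> | ->]].
    + rewrite f0, !mix_even. reflexivity.
    + rewrite f1, !mix_odd, mix_even. reflexivity.
  - rewrite L. symmetry. apply sat_rename.
    intro i. destruct (even_or_odd i) as [j [-> | ->]].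
    + rewrite g0, !mix_even. reflexivity.
    + rewrite g1, !mix_odd. reflexivity.
Qed.

Lemma definable_and P Q : definable P -> definable Q -> definable (fun s => P s /\ Q s).
Proof. apply (definable_bin (op := FAnd)); simpl; tauto. Qed.

Lemma definable_or P Q : definable P -> definable Q -> definable (fun s => P s \/ Q s).
Proof. apply (definable_bin (op := FOr)); simpl; tauto. Qed.

Lemma definable_imp P Q : definable P -> definable Q -> definable (fun s => P s -> Q s).
Proof. apply (definable_bin (op := FImp) (OP := fun A B => A -> B)); simpl; tauto. Qed.

Lemma definable_iff P Q : definable P -> definable Q -> definable (fun s => P s <-> Q s).
Proof. intros H K. apply definable_and; apply definable_imp; assumption. Qed.

(** A proposition without free variables is, classically, a mere truth value. *)
Lemma definable_const (P : Prop) : definable (fun _ => P).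
Proof.
  destruct (zf_infinity M) as (w & _).
  destruct (classic P) as [H|H].
  - exists (FEq 0 0), (fun _ => w). intro s. simpl. tauto.
  - exists FFalse, (fun _ => w). intro s. simpl. tauto.
Qed.

Lemma definable_not P : definable P -> definable (fun s => ~ P s).
Proof. intro H. apply definable_imp; [exact H|apply definable_const]. Qed.

(** A quantifier of a formula puts its witness in front of the interleaved sequence, but
    the predicate wants it in front of the variables. *)
Lemma mix_scons : exists f : nat -> nat, forall x s t i,
  mix (scons x s) t i = scons x (mix s t) (f i).
Proof.
  exists (fun i => match i with
             | O => O
             | S j => if Nat.even j then S i else j end).
  intros x s t i. destruct (even_or_odd i) as [j [-> | ->]].
  - rewrite mix_even. destruct j as [|j]; [reflexivity|].
    replace (2 * S j) with (S (S (2 * j))) by lia.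
    cbv beta iota. rewrite Nat.even_succ, Nat.odd_mul. cbn [Nat.odd negb Nat.even andb scons].
    symmetry. apply mix_even.
  - rewrite mix_odd. cbv beta iota. rewrite Nat.even_mul. cbn [Nat.even orb scons].
    symmetry. apply mix_odd.
Qed.

Lemma definable_all (R : M -> (nat -> M) -> Prop) :
  definable (fun s => R (s 0) (tl s)) -> definable (fun s => forall x, R x s).
Proof.
  intros (p & t & K). destruct mix_scons as (f & Hf).
  exists (FAll (rename f p)), t. intro s. simpl.
  split; intros H x; specialize (H x).
  - apply (sat_rename (mix (scons x s) t)); [apply Hf|].
    apply (K (scons x s)), H.
  - apply (K (scons x s)). apply (sat_rename (mix (scons x s) t)) in H; [exact H|apply Hf].
Qed.

Lemma definable_ex (R : M -> (nat -> M) -> Prop) :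
  definable (fun s => R (s 0) (tl s)) -> definable (fun s => exists x, R x s).
Proof.
  intro H. apply definable_ext with (fun s => ~ forall x, ~ R x s).
  - intro s. split.
    + intro K. apply NNPP. intro L. apply K. intros x Hx. apply L. exists x. exact Hx.
    + intros [x Hx] K. exact (K x Hx).
  - apply definable_not, definable_all, (definable_not H).
Qed.

Lemma definable_mem_var i j : definable (fun s => s i ∈ s j).
Proof.
  destruct (zf_infinity M) as (w & _).
  exists (FMem (2 * i) (2 * j)), (fun _ => w). intro s. cbn [sat]. rewrite !mix_even. tauto.
Qed.

Lemma term_var k : definable_term (fun s => s k).
Proof.
  destruct (zf_infinity M) as (w & _).
  exists (FEq (2 * 0) (2 * S k)), (fun _ => w). intro s. cbn [sat]. rewrite !mix_even. tauto.
Qed.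

Lemma term_const c : definable_term (fun _ => c).
Proof.
  exists (FEq (2 * 0) (S (2 * 0))), (fun _ => c). intro s. cbn [sat].
  rewrite mix_even, mix_odd. tauto.
Qed.

Lemma term_shift t : definable_term t -> definable_term (fun s => t (tl s)).
Proof.
  exact (definable_rename (P := fun s => s 0 = t (tl s))
           (fun i => match i with O => O | S j => S (S j) end)).
Qed.

(** Substitution of a term for a variable costs one existential quantifier. *)
Lemma definable_sub1 P t : definable1 P -> definable_term t -> definable (fun s => P (t s)).
Proof.
  intros HP Ht. apply definable_ext with (fun s => exists y, y = t s /\ P y).
  - intro s. split; [intros (y & -> & H); exact H|eauto].
  - apply definable_ex, definable_and; [exact Ht|exact HP].
Qed.

Lemma definable_sub2 P t u : definable2 P -> definable_term t -> definable_term u ->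
  definable (fun s => P (t s) (u s)).
Proof.
  intros HP Ht Hu.
  apply definable_ext with (fun s => exists y, y = u s /\ exists x, x = t s /\ P x y).
  - intro s. split; [intros (y & -> & x & -> & H); exact H|eauto 6].
  - apply definable_ex, definable_and; [exact Hu|].
    apply definable_ex, definable_and; [exact (term_shift Ht)|exact HP].
Qed.

Lemma definable_sub3 P t u v :
  definable3 P -> definable_term t -> definable_term u -> definable_term v ->
  definable (fun s => P (t s) (u s) (v s)).
Proof.
  intros HP Ht Hu Hv.
  apply definable_ext with (fun s => exists z, z = v s /\ exists y, y = u s /\
                                exists x, x = t s /\ P x y z).
  - intro s. split; [intros (z & -> & y & -> & x & -> & H); exact H|eauto 8].
  - apply definable_ex, definable_and; [exact Hv|].
    apply definable_ex, definable_and; [exact (term_shift Hu)|].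
    apply definable_ex, definable_and; [exact (term_shift (term_shift Ht))|exact HP].
Qed.

Lemma term_sub1 (f : M -> M) t :
  definable_fun1 f -> definable_term t -> definable_term (fun s => f (t s)).
Proof.
  intros Hf Ht.
  exact (definable_sub2 (P := fun y x => y = f x) Hf (term_var 0) (term_shift Ht)).
Qed.

Lemma term_sub2 (f : M -> M -> M) t u :
  definable_fun2 f -> definable_term t -> definable_term u ->
  definable_term (fun s => f (t s) (u s)).
Proof.
  intros Hf Ht Hu.
  exact (definable_sub3 (P := fun y x z => y = f x z) Hf (term_var 0)
           (term_shift Ht) (term_shift Hu)).
Qed.

Lemma definable_mem t u : definable_term t -> definable_term u -> definable (fun s => t s ∈ u s).
Proof. apply (definable_sub2 (P := @mem M)), definable_mem_var. Qed.

Lemma definable_eq t u : definable_term t -> definable_term u -> definable (fun s => t s = u s).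
Proof. apply (definable_sub2 (P := @eq M)), (term_var 0). Qed.

(** * Set terms *)

Lemma model_inhabited : inhabited M.
Proof. destruct (zf_infinity M) as (w & _). exact (inhabits w). Qed.

(** Total, so that set-builder terms need no proof of existence when they are written; the
    value is arbitrary if the class is proper. *)
Definition compr (Q : M -> Prop) : M :=
  epsilon model_inhabited (fun b => forall x, x ∈ b <-> Q x).

Lemma in_compr Q : (exists b, forall x, x ∈ b <-> Q x) ->
  forall x, x ∈ compr Q <-> Q x.
Proof. intro H. exact (epsilon_spec model_inhabited _ H). Qed.

Lemma separation_env (P : M -> (nat -> M) -> Prop) :
  definable (fun s => P (s 0) (tl s)) ->
  forall s a, exists b, forall x, x ∈ b <-> x ∈ a /\ P x s.
Proof.
  intros (p & t & K) s a. destruct mix_scons as (f & Hf).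
  destruct (zf_separation (rename f p) (mix s t) a) as (b & Hb).
  exists b. intro x. rewrite Hb.
  rewrite (sat_rename (mix (scons x s) t)) by apply Hf.
  rewrite <- (K (scons x s)). tauto.
Qed.

Definition sep (a : M) (P : M -> Prop) : M := compr (fun x => x ∈ a /\ P x).

Lemma in_sep a P x : definable1 P -> x ∈ sep a P <-> x ∈ a /\ P x.
Proof.
  intro H. apply (in_compr (Q := fun x => x ∈ a /\ P x)).
  apply (separation_env (P := fun x _ => P x) H (fun _ => a)).
Qed.

(** By extensionality the separated set is determined by its elements, so that set-builder
    terms with parameters may occur in further definable relations. *)
Lemma term_sep (a : (nat -> M) -> M) (P : M -> (nat -> M) -> Prop) :
  definable_term a -> definable (fun s => P (s 0) (tl s)) ->
  definable_term (fun s => sep (a s) (fun x => P x s)).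
Proof.
  intros Ha HP.
  apply definable_ext with (fun s => forall x, x ∈ s 0 <-> x ∈ a (tl s) /\ P x (tl s)).
  - intro s.
    assert (K : forall x, x ∈ sep (a (tl s)) (fun x => P x (tl s))
                  <-> x ∈ a (tl s) /\ P x (tl s)).
    { apply (in_compr (Q := fun x => x ∈ a (tl s) /\ P x (tl s))).
      apply (separation_env HP). }
    split; intro H.
    + apply zf_extensionality. intro x. rewrite H, K. tauto.
    + intro x. rewrite H. apply K.
  - apply definable_all, definable_iff; [exact (definable_mem_var 0 1)|apply definable_and].
    + exact (definable_mem (term_var 0) (term_shift (term_shift Ha))).
    + exact (definable_rename (fun i => match i with O => O | S j => S (S j) end) HP).
Qed.

Lemma definable_fun1_char (f : M -> M) (Q : M -> M -> Prop) :
  (forall a x, x ∈ f a <-> Q a x) -> definable2 Q -> definable_fun1 f.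
Proof.
  intros H HQ. apply definable_ext with (fun s => forall x, x ∈ s 0 <-> Q (s 1) x).
  - intro s. split; intro K.
    + apply zf_extensionality. intro x. rewrite K. symmetry. apply H.
    + intro x. rewrite K. apply H.
  - apply definable_all, definable_iff; [exact (definable_mem_var 0 1)|].
    exact (definable_sub2 HQ (term_var 2) (term_var 0)).
Qed.

Lemma definable_fun2_char (f : M -> M -> M) (Q : M -> M -> M -> Prop) :
  (forall a b x, x ∈ f a b <-> Q a b x) -> definable3 Q -> definable_fun2 f.
Proof.
  intros H HQ. apply definable_ext with (fun s => forall x, x ∈ s 0 <-> Q (s 1) (s 2) x).
  - intro s. split; intro K.
    + apply zf_extensionality. intro x. rewrite K. symmetry. apply H.
    + intro x. rewrite K. apply H.
  - apply definable_all, definable_iff; [exact (definable_mem_var 0 1)|].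
    exact (definable_sub3 HQ (term_var 2) (term_var 3) (term_var 0)).
Qed.

End Definability.

Create HintDb definability.

Ltac registered := first [assumption | solve [auto 1 with definability nocore]].

Ltac term_step :=
  match goal with
  | |- definable_term (fun s => ?f (@?t s) (@?u s)) =>
      apply (term_sub2 (f := f) (t := t) (u := u)); [registered| |]
  | |- definable_term (fun s => ?f (@?t s)) =>
      apply (term_sub1 (f := f) (t := t)); [registered|]
  end.

(* The predicate may be a partial application, as in [maps f]; the reading with most
   arguments for which definability is known is chosen, and the arguments become terms. *)
Ltac definable_step :=
  match goal with
  | |- definable (fun s => ?P (@?t s) (@?u s) (@?v s)) =>
      apply (definable_sub3 (P := P) (t := t) (u := u) (v := v)); [registered| | |]
  | |- definable (fun s => ?P (@?t s) (@?u s)) =>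
      apply (definable_sub2 (P := P) (t := t) (u := u)); [registered| |]
  | |- definable (fun s => ?P (@?t s)) =>
      apply (definable_sub1 (P := P) (t := t)); [registered|]
  end.

Ltac definability_loop :=
  lazymatch goal with
  | |- definable_term (fun s => s ?k) => exact (term_var k)
  | |- definable_term (fun _ => ?c) => exact (term_const c)
  | |- definable_term (fun s => sep (@?a s) (fun x => @?P s x)) =>
      apply (term_sep (a := a) (P := fun x s => P s x)); definability_loop
  | |- definable_term _ => term_step; definability_loop
  | |- definable _ =>
      cbv beta delta [tl];
      lazymatch goal with
      | |- definable (fun _ => ?P) => exact (definable_const P)
      | |- context [@unique] => unfold unique; definability_loop
      | |- definable (fun s => @?P s /\ @?Q s) =>
          apply (definable_and (P := P) (Q := Q)); definability_loop
      | |- definable (fun s => @?P s \/ @?Q s) =>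
          apply (definable_or (P := P) (Q := Q)); definability_loop
      | |- definable (fun s => @?P s <-> @?Q s) =>
          apply (definable_iff (P := P) (Q := Q)); definability_loop
      | |- definable (fun s => ~ @?P s) => apply (definable_not (P := P)); definability_loop
      | |- definable (fun s => exists x : carrier _, @?P s x) =>
          apply (definable_ex (R := fun x s => P s x)); definability_loop
      | |- definable (fun s => forall x : carrier _, @?P s x) =>
          apply (definable_all (R := fun x s => P s x)); definability_loop
      | |- definable (fun s => @?P s -> @?Q s) =>
          apply (definable_imp (P := P) (Q := Q)); definability_loop
      | |- definable (fun s => @?t s ∈ @?u s) =>
          apply (definable_mem (t := t) (u := u)); definability_loop
      | |- definable (fun s => @eq (carrier _) (@?t s) (@?u s)) =>
          apply (definable_eq (t := t) (u := u)); definability_loop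
      | |- _ => definable_step; definability_loop
      end
  | |- ?G =>
      let G' := eval cbv beta delta
        [definable1 definable2 definable3 definable_fun1 definable_fun2] in G in
      lazymatch G' with definable _ => idtac | definable_term _ => idtac end;
      change G'; definability_loop
  end.

Ltac definability := solve [definability_loop].

Section Terms.

Context {M : zf_model}.
Implicit Types (A B C a b c f i p s u v x y z : M).

Lemma set_ext a b : (forall x, x ∈ a <-> x ∈ b) -> a = b.
Proof. apply zf_extensionality. Qed.

Definition empty : M := sep (epsilon model_inhabited (fun _ => True)) (fun _ => False).
Definition power a : M := compr (fun x => subset x a).
Definition union a : M := compr (fun x => exists y, y ∈ a /\ x ∈ y).
Definition upair a b : M := compr (fun x => x = a \/ x = b).
Definition adjoin a b : M := compr (fun x => x ∈ a \/ x = b).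
Definition pair a b : M := upair (upair a a) (upair a b).
(** The union of all values of [f] at [i]. It is defined for all [f] and [i] and equals the
    value if [f] is a function. *)
Definition app f i : M := compr (fun u => exists v, maps f i v /\ u ∈ v).

Lemma in_empty x : ~ x ∈ empty.
Proof. unfold empty. rewrite in_sep by definability. tauto. Qed.

Lemma in_power a x : x ∈ power a <-> subset x a.
Proof. apply (in_compr (zf_powerset a)). Qed.

Lemma in_union a x : x ∈ union a <-> exists y, y ∈ a /\ x ∈ y.
Proof. apply (in_compr (zf_union a)). Qed.

Lemma in_upair a b x : x ∈ upair a b <-> x = a \/ x = b.
Proof. apply (in_compr (zf_pairing a b)). Qed.

Lemma in_adjoin a b x : x ∈ adjoin a b <-> x ∈ a \/ x = b.
Proof.
  apply (in_compr (Q := fun x => x ∈ a \/ x = b)). exists (union (upair a (upair b b))).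
  intro z. rewrite in_union. split.
  - intros (y & Hy & Hz). apply in_upair in Hy as [-> | ->]; [tauto|].
    apply in_upair in Hz. tauto.
  - intros [H | ->]; [exists a|exists (upair b b)]; rewrite !in_upair; tauto.
Qed.

Lemma is_upairE p a b : is_upair p a b <-> p = upair a b.
Proof.
  split.
  - intro H. apply set_ext. intro x. rewrite in_upair. apply H.
  - intros -> x. apply in_upair.
Qed.

Lemma is_pairE p a b : is_pair p a b <-> p = pair a b.
Proof.
  unfold is_pair, pair. setoid_rewrite is_upairE. apply is_upairE.
Qed.

Lemma pair_inj a b c d : pair a b = pair c d -> a = c /\ b = d.
Proof.
  intro H.
  assert (U : forall x y z, upair x x = upair y z -> x = y /\ x = z).
  { intros x y z K. assert (Hy : y ∈ upair x x) by (rewrite K, in_upair; tauto).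
    assert (Hz : z ∈ upair x x) by (rewrite K, in_upair; tauto).
    apply in_upair in Hy, Hz. intuition congruence. }
  assert (V : forall x y z, upair x y = upair x z -> y = z).
  { intros x y z K. assert (Hy : y ∈ upair x z) by (rewrite <- K, in_upair; tauto).
    assert (Hz : z ∈ upair x y) by (rewrite K, in_upair; tauto).
    apply in_upair in Hy, Hz. intuition congruence. }
  assert (E : a = c).
  { assert (K : upair a a ∈ pair c d) by (rewrite <- H; apply in_upair; tauto).
    apply in_upair in K as [K|K]; apply U in K; tauto. }
  subst c. split; [reflexivity|]. exact (V _ _ _ (V _ _ _ H)).
Qed.

Lemma mapsE f a b : maps f a b <-> pair a b ∈ f.
Proof.
  unfold maps. setoid_rewrite is_pairE. split; [intros (p & -> & H); exact H|eauto].
Qed.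

Lemma in_app f i u : u ∈ app f i <-> exists v, pair i v ∈ f /\ u ∈ v.
Proof.
  setoid_rewrite <- mapsE.
  apply (in_compr (Q := fun u => exists v, maps f i v /\ u ∈ v)).
  exists (sep (union (union (union f))) (fun u => exists v, maps f i v /\ u ∈ v)).
  intro x. rewrite in_sep.
  - split; [tauto|]. intro H. split; [|exact H].
    destruct H as (v & Hv & Hx). apply mapsE in Hv.
    apply in_union. exists v. split; [|exact Hx].
    apply in_union. exists (upair i v). split; [|apply in_upair; tauto].
    apply in_union. exists (pair i v). split; [exact Hv|apply in_upair; tauto].
  - unfold maps, is_pair, is_upair. definability.
Qed.

Lemma definable_subset : definable2 (@subset M).
Proof. unfold subset. definability. Qed.
Lemma term_power : definable_fun1 power.
Proof. apply (definable_fun1_char in_power). unfold subset. definability. Qed.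
Lemma term_union : definable_fun1 union.
Proof. apply (definable_fun1_char in_union). definability. Qed.
Lemma term_upair : definable_fun2 upair.
Proof. apply (definable_fun2_char in_upair). definability. Qed.
Lemma term_adjoin : definable_fun2 adjoin.
Proof. apply (definable_fun2_char in_adjoin). definability. Qed.
Local Hint Resolve term_upair : definability.
Lemma term_pair : definable_fun2 pair.
Proof. unfold pair. definability. Qed.
Local Hint Resolve term_pair : definability.
Lemma term_app : definable_fun2 app.
Proof. apply (definable_fun2_char in_app). definability. Qed.

End Terms.

#[export] Hint Resolve definable_subset term_power term_union term_upair term_adjoin
  term_pair term_app : definability.

(** * Functions as sets of pairs *)

Section Functions.

Context {M : zf_model}.
Implicit Types (A B C a b c f i p s u v x y z : M).

Lemma definable_maps : definable3 (@maps M).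
Proof. unfold maps, is_pair, is_upair. definability. Qed.

Definition prod A B : M := sep (power (power (adjoin (union (upair A B)) A)))
  (fun p => exists a b, a ∈ A /\ b ∈ B /\ p = pair a b).

Lemma in_prod A B p : p ∈ prod A B <-> exists a b, a ∈ A /\ b ∈ B /\ p = pair a b.
Proof.
  unfold prod. rewrite in_sep by definability. split; [tauto|]. intro H. split; [|exact H].
  destruct H as (a & b & Ha & Hb & ->). apply in_power. intros u Hu.
  apply in_power. intros x Hx. apply in_adjoin. left. apply in_union.
  apply in_upair in Hu as [-> | ->]; apply in_upair in Hx as [-> | ->];
    (exists A + exists B); rewrite in_upair; tauto.
Qed.

Lemma pair_in_prod A B a b : pair a b ∈ prod A B <-> a ∈ A /\ b ∈ B.
Proof.
  rewrite in_prod. split.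
  - intros (c & d & Hc & Hd & E). apply pair_inj in E as [-> ->]. tauto.
  - intros [Ha Hb]. exists a, b. tauto.
Qed.

Definition graph A B (G : M -> M -> Prop) : M :=
  sep (prod A B) (fun p => exists a b, p = pair a b /\ G a b).

Lemma pair_in_graph A B G a b : definable2 G ->
  pair a b ∈ graph A B G <-> a ∈ A /\ b ∈ B /\ G a b.
Proof.
  intro HG. unfold graph. rewrite in_sep by definability. rewrite pair_in_prod. split.
  - intros [H (c & d & E & K)]. apply pair_inj in E as [-> ->]. tauto.
  - intros (Ha & Hb & H). eauto 6.
Qed.

Lemma is_functionE f A B : is_function f A B <->
  subset f (prod A B) /\ (forall a, a ∈ A -> exists! b, pair a b ∈ f).
Proof.
  unfold is_function, unique. setoid_rewrite mapsE. setoid_rewrite is_pairE.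
  unfold subset. setoid_rewrite in_prod. tauto.
Qed.

Lemma graph_function A B G : definable2 G ->
  (forall a, a ∈ A -> exists b, b ∈ B /\ G a b /\ forall b', b' ∈ B -> G a b' -> b = b') ->
  is_function (graph A B G) A B.
Proof.
  intros HG H. apply is_functionE. split.
  - intros p Hp. unfold graph in Hp. rewrite in_sep in Hp by definability. tauto.
  - intros a Ha. destruct (H a Ha) as (b & Hb & K & L). exists b. split.
    + apply pair_in_graph; tauto.
    + intros b' Hb'. apply pair_in_graph in Hb' as (_ & U & V); auto.
Qed.

Lemma function_app f A B a b : is_function f A B -> pair a b ∈ f ->
  a ∈ A /\ b ∈ B /\ app f a = b.
Proof.
  intros Hf H. apply is_functionE in Hf as [Hs Hu].
  pose proof (Hs _ H) as K. apply pair_in_prod in K as [Ha Hb].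
  split; [exact Ha|split; [exact Hb|]].
  destruct (Hu a Ha) as (c & _ & Hc). apply set_ext. intro x. rewrite in_app. split.
  - intros (v & Hv & Hx). rewrite <- (Hc _ H), (Hc _ Hv). exact Hx.
  - eauto.
Qed.

Lemma function_maps f A B a : is_function f A B -> a ∈ A ->
  pair a (app f a) ∈ f /\ app f a ∈ B.
Proof.
  intros Hf Ha. pose proof Hf as K. apply is_functionE in K as [_ K].
  destruct (K a Ha) as (b & Hb & _).
  destruct (function_app Hf Hb) as (_ & H & ->). tauto.
Qed.

Lemma function_ext f g A B : is_function f A B -> is_function g A B ->
  (forall a, a ∈ A -> app f a = app g a) -> f = g.
Proof.
  assert (K : forall f g, is_function f A B -> is_function g A B ->
    (forall a, a ∈ A -> app f a = app g a) -> subset f g).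
  { clear. intros f g Hf Hg H p Hp. pose proof Hf as Hf'.
    apply is_functionE in Hf' as [Hs _].
    destruct (proj1 (in_prod _ _ _) (Hs _ Hp)) as (a & b & Ha & Hb & ->).
    destruct (function_app Hf Hp) as (_ & _ & <-). rewrite H by exact Ha.
    apply (function_maps Hg Ha). }
  intros Hf Hg H. apply set_ext. intro p. split; apply K; auto.
  intros; symmetry; auto.
Qed.

Lemma injectiveE f A B : is_function f A B ->
  (injective f <-> forall a a', a ∈ A -> a' ∈ A -> app f a = app f a' -> a = a').
Proof.
  intro Hf. unfold injective. setoid_rewrite mapsE. split.
  - intros H a a' Ha Ha' E. apply (H a a' (app f a)); [apply (function_maps Hf Ha)|].
    rewrite E. apply (function_maps Hf Ha').
  - intros H a a' b K L. apply (function_app Hf) in K, L.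
    apply H; try tauto. destruct K as (_ & _ & ->), L as (_ & _ & ->). reflexivity.
Qed.

Lemma surjectiveE f A B : is_function f A B ->
  (surjective f B <-> forall b, b ∈ B -> exists a, a ∈ A /\ app f a = b).
Proof.
  intro Hf. unfold surjective. setoid_rewrite mapsE. split; intros H b Hb.
  - destruct (H b Hb) as (a & K). apply (function_app Hf) in K. exists a. tauto.
  - destruct (H b Hb) as (a & Ha & <-). exists a. apply (function_maps Hf Ha).
Qed.

End Functions.

#[export] Hint Resolve definable_maps : definability.

(** * Finite sets and classes *)

Section Finite.

Context {M : zf_model}.
Implicit Types (A B C a b c f i p s u v x y z n : M).

Lemma definable_is_function : definable3 (@is_function M).
Proof. unfold is_function, is_pair, is_upair. definability. Qed.
Local Hint Resolve definable_is_function : definability.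

Lemma definable_natural : definable1 (@natural M).
Proof. unfold natural, inductive_set, is_empty, is_succ. definability. Qed.
Local Hint Resolve definable_natural : definability.

Lemma definable_equinumerous : definable2 (@equinumerous M).
Proof. unfold equinumerous, injective, surjective. definability. Qed.
Local Hint Resolve definable_equinumerous : definability.

Lemma definable_finite : definable1 (@finite M).
Proof. unfold finite. definability. Qed.

Lemma is_emptyE x : is_empty x <-> x = empty.
Proof.
  split; [intro H; apply set_ext; intro z|intros -> z; apply in_empty].
  pose proof (H z). pose proof (@in_empty M z). tauto.
Qed.

Lemma is_succE y x : is_succ y x <-> y = adjoin x x.
Proof.
  split; [intro H; apply set_ext; intro z; rewrite in_adjoin; apply H|intros -> z; apply in_adjoin].
Qed.

Lemma natural_empty : natural (@empty M).
Proof.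
  intros w [(e & He & H) _]. apply is_emptyE in He. congruence.
Qed.

Lemma natural_succ n : natural n -> natural (adjoin n n).
Proof.
  intros Hn w Hw. destruct (proj2 Hw n (Hn w Hw)) as (z & Hz & H).
  apply is_succE in Hz. congruence.
Qed.

Lemma natural_ind (P : M -> Prop) : definable1 P -> P empty ->
  (forall n, natural n -> P n -> P (adjoin n n)) -> forall n, natural n -> P n.
Proof.
  intros HP H0 HS n Hn.
  destruct (zf_infinity M) as (w & (e & He & Hew) & Hw).
  assert (e = empty) as -> by (apply is_emptyE; exact He).
  assert (K : n ∈ sep w (fun x => natural x /\ P x)).
  { apply Hn. split.
    - exists empty. split; [apply is_emptyE; reflexivity|].
      rewrite in_sep by definability. auto using natural_empty.
    - intros y Hy. rewrite in_sep in Hy by definability. destruct Hy as (Hy & Ny & Py).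
      destruct (Hw y Hy) as (z & Hz & Hzw). exists z. split; [exact Hz|].
      apply is_succE in Hz. subst z. rewrite in_sep by definability.
      auto using natural_succ. }
  rewrite in_sep in K by definability. tauto.
Qed.

Lemma mem_irrefl x : ~ x ∈ x.
Proof.
  intro H. destruct (zf_foundation (a := upair x x)) as (y & Hy & K).
  - exists x. apply in_upair. tauto.
  - apply in_upair in Hy. assert (y = x) as -> by tauto.
    apply K. exists x. split; [exact H|apply in_upair; tauto].
Qed.

Lemma equinumerousE A B : equinumerous A B <-> exists f, is_function f A B /\
  (forall a a', a ∈ A -> a' ∈ A -> app f a = app f a' -> a = a') /\
  (forall b, b ∈ B -> exists a, a ∈ A /\ app f a = b).
Proof.
  split; intros (f & Hf & H); exists f; (split; [exact Hf|]);
    rewrite (injectiveE Hf), (surjectiveE Hf) in *; exact H.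
Qed.

Lemma finite_natural n : natural n -> finite n.
Proof.
  intro Hn. exists n. split; [exact Hn|]. apply equinumerousE.
  exists (graph n n (fun a b => a = b)).
  assert (K : is_function (graph n n (fun a b => a = b)) n n).
  { apply graph_function; [definability|]. intros a Ha. exists a. auto. }
  assert (L : forall a, a ∈ n -> app (graph n n (fun a b => a = b)) a = a).
  { intros a Ha. apply (function_app (a := a) (b := a) K).
    apply pair_in_graph; [definability|auto]. }
  split; [exact K|split].
  - intros a a' Ha Ha'. rewrite !L by assumption. auto.
  - intros b Hb. exists b. auto.
Qed.

Lemma finite_empty : finite (@empty M).
Proof. apply finite_natural, natural_empty. Qed.

Lemma adjoin_mem s a : a ∈ s -> adjoin s a = s.
Proof.
  intro H. apply set_ext. intro x. rewrite in_adjoin. split; [intros [K| ->]|]; auto.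
Qed.

Lemma finite_adjoin s a : finite s -> finite (adjoin s a).
Proof.
  intros (n & Hn & H). destruct (classic (a ∈ s)) as [Ha|Ha].
  { rewrite (adjoin_mem Ha). exists n. auto. }
  exists (adjoin n n). split; [apply natural_succ, Hn|].
  apply equinumerousE in H as (f & Hf & Hi & Hs). apply equinumerousE.
  set (G := fun x y => (x ∈ s /\ y = app f x) \/ (x = a /\ y = n)).
  assert (HG : definable2 G) by (unfold G; definability).
  assert (K : is_function (graph (adjoin s a) (adjoin n n) G) (adjoin s a) (adjoin n n)).
  { apply graph_function; [exact HG|]. unfold G. intros x Hx.
    apply in_adjoin in Hx as [Hx| ->].
    - exists (app f x). rewrite in_adjoin. repeat split; auto.
      + left. apply (function_maps Hf Hx).
      + intros b _ [[_ Hb]|[-> _]]; [auto|tauto].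
    - exists n. rewrite in_adjoin. repeat split; auto.
      intros b _ [[Hb _]|[_ Hb]]; [tauto|auto]. }
  assert (L1 : forall x, x ∈ s -> app (graph (adjoin s a) (adjoin n n) G) x = app f x).
  { intros x Hx. apply (function_app (b := app f x) K). apply pair_in_graph; [exact HG|].
    rewrite !in_adjoin. unfold G. pose proof (function_maps Hf Hx). tauto. }
  assert (L2 : app (graph (adjoin s a) (adjoin n n) G) a = n).
  { apply (function_app (b := n) K). apply pair_in_graph; [exact HG|].
    rewrite !in_adjoin. unfold G. tauto. }
  exists (graph (adjoin s a) (adjoin n n) G). split; [exact K|split].
  - assert (D : forall x, x ∈ s -> app f x <> n).
    { intros x Hx E. pose proof (function_maps Hf Hx) as [_ W]. rewrite E in W.
      exact (mem_irrefl W). }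
    intros x y Hx Hy. apply in_adjoin in Hx as [Hx| ->]; apply in_adjoin in Hy as [Hy| ->];
      rewrite ?L2, ?L1 by assumption; auto.
    + intro E. destruct (D x Hx E).
    + intro E. destruct (D y Hy); auto.
  - intros b Hb. apply in_adjoin in Hb as [Hb| ->].
    + destruct (Hs b Hb) as (x & Hx & <-). exists x. rewrite in_adjoin, L1; auto.
    + exists a. rewrite in_adjoin. auto.
Qed.

(** The size of [s] is a possibly nonstandard number of the model; the induction along it
    is the minimality of the model's natural numbers, hence the definability of [P]. *)
Lemma finite_ind (P : M -> Prop) : definable1 P -> P empty ->
  (forall s a, finite s -> ~ a ∈ s -> P s -> P (adjoin s a)) ->
  forall s, finite s -> P s.
Proof.
  intros HP H0 HS s (n & Hn & H). revert s H.
  revert n Hn. apply (natural_ind (P := fun n => forall s, equinumerous s n -> P s)).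
  - definability.
  - intros s Hs. apply equinumerousE in Hs as (f & Hf & _).
    replace s with (@empty M); [exact H0|]. symmetry. apply is_emptyE. intros x Hx.
    apply (@in_empty M (app f x)), (function_maps Hf Hx).
  - intros n Hn IH s Hs. pose proof Hs as Hs0.
    apply equinumerousE in Hs as (f & Hf & Hi & Hs).
    destruct (Hs n) as (a & Ha & Ea); [apply in_adjoin; tauto|].
    set (t := sep s (fun x => x <> a)).
    assert (Ht : forall x, x ∈ t <-> x ∈ s /\ x <> a)
      by (intro x; unfold t; rewrite in_sep by definability; tauto).
    assert (E : s = adjoin t a).
    { apply set_ext. intro x. rewrite in_adjoin, Ht. destruct (classic (x = a)) as [->|]; tauto. }
    assert (K : equinumerous t n).
    { apply equinumerousE. set (G := fun x y => y = app f x).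
      assert (HG : definable2 G) by (unfold G; definability).
      assert (L : forall x, x ∈ t -> app f x ∈ n).
      { intros x Hx. apply Ht in Hx as [Hx Hxa].
        pose proof (function_maps Hf Hx) as [_ W]. apply in_adjoin in W as [W|W]; [exact W|].
        destruct Hxa. apply Hi; congruence. }
      assert (Kf : is_function (graph t n G) t n).
      { apply graph_function; [exact HG|]. intros x Hx. exists (app f x). unfold G.
        repeat split; auto. }
      assert (La : forall x, x ∈ t -> app (graph t n G) x = app f x).
      { intros x Hx. apply (function_app (b := app f x) Kf). apply pair_in_graph; [exact HG|].
        unfold G. auto. }
      exists (graph t n G). split; [exact Kf|split].
      - intros x y Hx Hy. rewrite !La by assumption. apply Ht in Hx, Hy. apply Hi; tauto.
      - intros b Hb. destruct (Hs b) as (x & Hx & Ex); [apply in_adjoin; tauto|].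
        assert (x ∈ t).
        { apply Ht. split; [exact Hx|]. intros ->. apply (@mem_irrefl n). congruence. }
        exists x. rewrite La; auto. }
    rewrite E. apply HS; [|rewrite Ht; tauto|apply IH, K].
    exists n. auto.
Qed.

End Finite.

#[export] Hint Resolve definable_is_function definable_finite definable_natural : definability.

Section FiniteClasses.

Context {M : zf_model}.
Implicit Types (A B C G W Y Z a b c f i p s t u v x y z n : M).

(** Only an upper bound is asked for, so that [P] may be undefinable and subclasses are
    immediate. *)
Definition finite_class (P : M -> Prop) : Prop :=
  exists s, finite s /\ forall x, P x -> x ∈ s.

Lemma finite_class_sub (P Q : M -> Prop) :
  (forall x, P x -> Q x) -> finite_class Q -> finite_class P.
Proof. intros H (s & Hs & K). exists s. auto. Qed.

Lemma finite_sub s t : finite s -> subset t s -> finite t.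
Proof.
  intro Hs. revert t.
  apply (finite_ind (P := fun s => forall t, subset t s -> finite t)); [definability| | |exact Hs].
  - intros t Ht. replace t with (@empty M); [apply finite_empty|].
    symmetry. apply is_emptyE. intros x Hx. exact (in_empty (Ht x Hx)).
  - clear s Hs. intros s a _ _ IH t Ht.
    assert (K : finite (sep t (fun x => x <> a))).
    { apply IH. intros x Hx. rewrite in_sep in Hx by definability. destruct Hx as [Hx Hxa].
      apply Ht in Hx. apply in_adjoin in Hx. tauto. }
    destruct (classic (a ∈ t)) as [Ha|Ha].
    + replace t with (adjoin (sep t (fun x => x <> a)) a); [apply finite_adjoin, K|].
      apply set_ext. intro x. rewrite in_adjoin, in_sep by definability.
      destruct (classic (x = a)) as [->|]; tauto.
    + replace t with (sep t (fun x => x <> a)); [exact K|].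
      apply set_ext. intro x. rewrite in_sep by definability.
      destruct (classic (x = a)) as [->|]; tauto.
Qed.

Lemma finite_class_set s : finite_class (fun x => x ∈ s) <-> finite s.
Proof.
  split; [intros (t & Ht & H); apply (finite_sub Ht H)|intro H; exists s; auto].
Qed.

Lemma finite_sep s P : definable1 P -> finite s -> finite (sep s P).
Proof.
  intros HP Hs. apply (finite_sub Hs). intros x Hx. rewrite in_sep in Hx by definability. tauto.
Qed.

Lemma finite_class_or (P Q : M -> Prop) :
  finite_class P -> finite_class Q -> finite_class (fun x => P x \/ Q x).
Proof.
  intros (s & Hs & HP) (t & Ht & HQ).
  assert (K : exists u, finite u /\ subset s u /\ subset t u).
  { apply (finite_ind (P := fun s => exists u, finite u /\ subset s u /\ subset t u));
      [definability| | |exact Hs].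
    - exists t. split; [exact Ht|]. split; [intros x Hx; destruct (in_empty Hx)|].
      intros x Hx. exact Hx.
    - intros r a _ _ (u & Hu & H1 & H2). exists (adjoin u a).
      split; [apply finite_adjoin, Hu|]. split; intros x Hx; rewrite in_adjoin; auto.
      apply in_adjoin in Hx as [Hx|Hx]; auto. }
  destruct K as (u & Hu & H1 & H2). exists u. split; [exact Hu|].
  intros x [Hx|Hx]; auto.
Qed.

Lemma finite_class_one a : finite_class (fun x => x = a).
Proof.
  exists (adjoin empty a). split; [apply finite_adjoin, finite_empty|].
  intros x Hx. apply in_adjoin. auto.
Qed.

Lemma finite_class_unique (P : M -> Prop) : (forall x y, P x -> P y -> x = y) -> finite_class P.
Proof.
  intro H. destruct (classic (exists x, P x)) as [[x Hx]|K].
  - apply (finite_class_sub (Q := fun y => y = x)); [auto|apply finite_class_one].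
  - exists empty. split; [apply finite_empty|]. intros x Hx. destruct K. eauto.
Qed.

(** The bounds of the classes [P x] are not chosen: they are collected into one finite set
    by induction on [s]. *)
Lemma finite_class_Union s (P : M -> M -> Prop) : definable2 P -> finite s ->
  (forall x, x ∈ s -> finite_class (P x)) -> finite_class (fun u => exists x, x ∈ s /\ P x u).
Proof.
  intros HP Hs.
  apply (finite_ind (P := fun s => (forall x, x ∈ s -> finite_class (P x)) ->
                                finite_class (fun u => exists x, x ∈ s /\ P x u)));
    [unfold finite_class; definability| | |exact Hs].
  - intros _. exists empty. split; [apply finite_empty|].
    intros u (x & Hx & _). destruct (in_empty Hx).
  - clear s Hs. intros s a _ _ IH H.
    apply (finite_class_sub (Q := fun u => (exists x, x ∈ s /\ P x u) \/ P a u)).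
    + intros u (x & Hx & K). apply in_adjoin in Hx as [Hx| ->]; eauto.
    + apply finite_class_or; [apply IH|]; intros; apply H, in_adjoin; auto.
Qed.

Lemma finite_power s : finite s -> finite (power s).
Proof.
  apply (finite_ind (P := fun s => finite (power s))); [definability| |].
  - apply finite_class_set. apply finite_class_unique. intros x y Hx Hy. apply in_power in Hx, Hy.
    apply set_ext. intro z. split; intro Hz; [apply Hx in Hz|apply Hy in Hz];
      destruct (in_empty Hz).
  - clear s. intros s a _ _ IH. apply finite_class_set.
    apply (finite_class_sub (Q := fun t =>
      t ∈ power s \/ exists r, r ∈ power s /\ t = adjoin r a)).
    + intros t Ht. apply in_power in Ht.
      assert (K : sep t (fun x => x <> a) ∈ power s).
      { apply in_power. intros x Hx. rewrite in_sep in Hx by definability. destruct Hx as [Hx Hxa].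
        apply Ht in Hx. apply in_adjoin in Hx. tauto. }
      destruct (classic (a ∈ t)) as [Ha|Ha].
      * right. exists (sep t (fun x => x <> a)). split; [exact K|].
        apply set_ext. intro x. rewrite in_adjoin, in_sep by definability.
        destruct (classic (x = a)) as [->|]; tauto.
      * left. replace t with (sep t (fun x => x <> a)); [exact K|].
        apply set_ext. intro x. rewrite in_sep by definability.
        destruct (classic (x = a)) as [->|]; tauto.
    + apply finite_class_or; [apply finite_class_set, IH|].
      apply (finite_class_Union (P := fun r t => t = adjoin r a)); [definability|exact IH|].
      intros; apply finite_class_one.
Qed.

Lemma finite_prod s t : finite s -> finite t -> finite (prod s t).
Proof.
  intros Hs Ht. apply finite_class_set.
  apply (finite_class_sub (Q := fun p => exists a, a ∈ s /\ exists b, b ∈ t /\ p = pair a b)).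
  - intros p Hp. apply in_prod in Hp as (a & b & Ha & Hb & E). eauto 6.
  - apply (finite_class_Union (P := fun a p => exists b, b ∈ t /\ p = pair a b));
      [definability|exact Hs|].
    intros a _. apply (finite_class_Union (P := fun b p => p = pair a b)); [definability|exact Ht|].
    intros; apply finite_class_one.
Qed.

(** The usual reduction to plain induction on a bound [Z] of [Y] changes the predicate from
    [Y] to [Y] together with [adjoin Y a]. To let the predicate vary inside a definable
    statement, it is replaced by a set [G]. *)
Lemma finite_strong_ind (P : M -> Prop) : definable1 P ->
  (forall Y, finite Y -> (forall Y', subset Y' Y -> Y' <> Y -> P Y') -> P Y) ->
  forall Y, finite Y -> P Y.
Proof.
  intros HP Hrec.
  assert (K : forall Z, finite Z -> forall G,
    (forall Y, subset Y Z -> (forall Y', subset Y' Y -> Y' <> Y -> Y' ∈ G) -> Y ∈ G) ->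
    forall Y, subset Y Z -> Y ∈ G).
  { apply (finite_ind (P := fun Z => forall G,
      (forall Y, subset Y Z -> (forall Y', subset Y' Y -> Y' <> Y -> Y' ∈ G) -> Y ∈ G) ->
      forall Y, subset Y Z -> Y ∈ G)); [definability| |].
    - intros G H Y HY. apply (H Y HY). intros Y' H1 H2. destruct H2.
      apply set_ext. intro x. split; [apply H1|]. intro Hx. destruct (in_empty (HY x Hx)).
    - intros Z a _ _ IH G H.
      assert (L : forall Y, subset Y Z ->
        Y ∈ sep G (fun Y => adjoin Y a ∈ G)).
      { apply IH. intros Y HY K. rewrite in_sep by definability.
        assert (K1 : forall Y', subset Y' Y -> Y' <> Y -> Y' ∈ G /\ adjoin Y' a ∈ G).
        { intros Y' H1 H2. specialize (K Y' H1 H2). rewrite in_sep in K by definability. exact K. }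
        assert (HYG : Y ∈ G).
        { apply H; [intros x Hx; apply in_adjoin; auto|]. intros Y' H1 H2. apply (K1 Y' H1 H2). }
        split; [exact HYG|]. apply H.
        { intros x Hx. apply in_adjoin in Hx as [Hx|Hx]; apply in_adjoin; auto. }
        intros Y' H1 H2. destruct (classic (a ∈ Y')) as [Ha|Ha].
        - set (D := sep Y' (fun x => x <> a \/ a ∈ Y)).
          assert (HD : forall x, x ∈ D <-> x ∈ Y' /\ (x <> a \/ a ∈ Y))
            by (intro x; unfold D; rewrite in_sep by definability; tauto).
          assert (E : Y' = adjoin D a).
          { apply set_ext. intro x. rewrite in_adjoin, HD.
            destruct (classic (x = a)) as [->|]; tauto. }
          rewrite E. apply K1.
          + intros x Hx. apply HD in Hx as [Hx Hxa]. apply H1 in Hx.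
            apply in_adjoin in Hx as [Hx| ->]; tauto.
          + intro E'. apply H2. rewrite E, E'. reflexivity.
        - destruct (classic (Y' = Y)) as [->|N]; [exact HYG|].
          apply K1; [|exact N]. intros x Hx. pose proof (H1 x Hx) as W.
          apply in_adjoin in W as [W| ->]; tauto. }
      intros Y HY.
      destruct (classic (a ∈ Y)) as [Ha|Ha].
      + replace Y with (adjoin (sep Y (fun x => x <> a)) a).
        * assert (W : sep Y (fun x => x <> a) ∈ sep G (fun Y => adjoin Y a ∈ G)).
          { apply L. intros x Hx. rewrite in_sep in Hx by definability. destruct Hx as [Hx Hxa].
            apply HY in Hx. apply in_adjoin in Hx. tauto. }
          rewrite in_sep in W by definability. tauto.
        * apply set_ext. intro x. rewrite in_adjoin, in_sep by definability.
          destruct (classic (x = a)) as [->|]; tauto.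
      + assert (W : Y ∈ sep G (fun Y => adjoin Y a ∈ G)).
        { apply L. intros x Hx. pose proof (HY x Hx) as W.
          apply in_adjoin in W as [W| ->]; tauto. }
        rewrite in_sep in W by definability. tauto. }
  intros Z HZ.
  assert (W : Z ∈ sep (power Z) P).
  { apply (K Z HZ); [|intros x Hx; exact Hx]. intros Y HY IH.
    rewrite in_sep by definability. split; [apply in_power, HY|].
    apply Hrec; [apply (finite_sub HZ HY)|]. intros Y' H1 H2.
    specialize (IH Y' H1 H2). rewrite in_sep in IH by definability. tauto. }
  rewrite in_sep in W by definability. tauto.
Qed.

Lemma finite_min (P : M -> Prop) s : definable1 P -> finite s -> P s ->
  exists Y, subset Y s /\ P Y /\ forall Y', subset Y' Y -> P Y' -> Y' = Y.
Proof.
  intros HP Hs.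
  apply (finite_strong_ind (P := fun s => P s ->
    exists Y, subset Y s /\ P Y /\ forall Y', subset Y' Y -> P Y' -> Y' = Y));
    [definability| |exact Hs].
  clear s Hs. intros s _ IH Ps.
  destruct (classic (exists Y', subset Y' s /\ Y' <> s /\ P Y')) as [(Y' & H1 & H2 & H3)|N].
  - destruct (IH Y' H1 H2 H3) as (Y & K1 & K2 & K3). exists Y.
    split; [intros x Hx; apply H1, K1, Hx|auto].
  - exists s. split; [intros x Hx; exact Hx|]. split; [exact Ps|].
    intros Y' H1 H2. apply NNPP. intro H3. apply N. eauto.
Qed.

(** Let [h] be the preimage operator on subsets of [Z]. By surjectivity [h] preserves
    proper inclusion. So if [h Z] were a proper subset of [Z], a minimal [Y] with [h Y]
    properly inside [Y] could be replaced by [h Y]. *)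
Lemma pigeonhole_total Z (g : M -> M -> Prop) : definable2 g -> finite Z ->
  (forall u v v', u ∈ Z -> g u v -> g u v' -> v = v') ->
  (forall z, z ∈ Z -> exists u, u ∈ Z /\ g u z) ->
  forall u, u ∈ Z -> exists z, z ∈ Z /\ g u z.
Proof.
  intros Hg HZ Hfun Hsurj.
  set (h := fun Y => sep Z (fun w => exists z, z ∈ Y /\ g w z)).
  assert (Hh : forall Y w, w ∈ h Y <-> w ∈ Z /\ exists z, z ∈ Y /\ g w z)
    by (intros Y w; unfold h; rewrite in_sep by definability; tauto).
  assert (dh : definable_fun1 h) by (unfold h; definability).
  clearbody h.
  destruct (classic (h Z = Z)) as [E|NE].
  { intros u Hu. rewrite <- E in Hu. apply Hh in Hu. tauto. }
  exfalso.
  destruct (finite_min (P := fun Y => subset Y Z /\ subset (h Y) Y /\ h Y <> Y) (s := Z))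
    as (Y & _ & (HY & H1 & H2) & H3).
  - definability.
  - exact HZ.
  - split; [intros x Hx; exact Hx|]. split; [|exact NE].
    intros x Hx. apply Hh in Hx. tauto.
  - apply H2. apply H3; [exact H1|].
    split; [intros x Hx; apply HY, H1, Hx|]. split.
    + intros x Hx. apply Hh in Hx as (Hx & z & Hz & K). apply Hh. eauto.
    + intro E. apply H2. apply set_ext. intro x. split; [apply H1|]. intro Hx.
      destruct (Hsurj x (HY x Hx)) as (u & Hu & K).
      assert (W : u ∈ h Y) by (apply Hh; eauto).
      rewrite <- E in W. apply Hh in W as (_ & z & Hz & L).
      rewrite (Hfun u x z Hu K L). exact Hz.
Qed.

(** If two points had the same image, [g] without one of them would still be surjective,
    against [pigeonhole_total]. *)
Lemma pigeonhole_injective Z (g : M -> M -> Prop) : definable2 g -> finite Z ->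
  (forall u v v', u ∈ Z -> g u v -> g u v' -> v = v') ->
  (forall z, z ∈ Z -> exists u, u ∈ Z /\ g u z) ->
  forall u u' z, u ∈ Z -> u' ∈ Z -> g u z -> g u' z -> u = u'.
Proof.
  intros Hg HZ Hfun Hsurj u u' z Hu Hu' K K'. apply NNPP. intro N.
  destruct (@pigeonhole_total Z (fun x v => x <> u /\ g x v)) with (u := u)
    as (v & _ & W & _); auto.
  - definability.
  - intros x v v' Hx [_ H] [_ H']. eauto.
  - intros y Hy. destruct (Hsurj y Hy) as (x & Hx & L).
    destruct (classic (x = u)) as [->|]; [|eauto].
    exists u'. rewrite (Hfun u y z Hu L K). auto.
Qed.

(** * Parity of finite sets *)

(** Among the subsets of [Z], the members of [G] are those of even size. This determines
    parity without counting. *)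
Definition alternating G Z : Prop := empty ∈ G /\
  forall Y a, subset (adjoin Y a) Z -> ~ a ∈ Y -> (adjoin Y a ∈ G <-> ~ Y ∈ G).

Definition even_set Y : Prop := exists G, alternating G Y /\ Y ∈ G.

Lemma alternating_exists Z : finite Z -> exists G, alternating G Z.
Proof.
  apply (finite_ind (P := fun Z => exists G, alternating G Z)).
  - unfold alternating. definability.
  - exists (adjoin empty empty). split; [apply in_adjoin; auto|].
    intros Y a H. destruct (@in_empty M a). apply H, in_adjoin. auto.
  - clear Z. intros Z a _ HaZ (G & HG0 & HG).
    set (G' := sep (power (adjoin Z a)) (fun Y => (~ a ∈ Y /\ Y ∈ G) \/
      (a ∈ Y /\ ~ sep Y (fun x => x <> a) ∈ G))).
    assert (HG' : forall Y, Y ∈ G' <-> subset Y (adjoin Z a) /\ ((~ a ∈ Y /\ Y ∈ G) \/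
      (a ∈ Y /\ ~ sep Y (fun x => x <> a) ∈ G))).
    { intro Y. unfold G'. rewrite in_sep by definability. rewrite in_power. tauto. }
    clearbody G'. exists G'. split.
    { apply HG'. split; [intros x Hx; destruct (in_empty Hx)|].
      left. split; [apply in_empty|exact HG0]. }
    intros Y b Hsub Hb. rewrite !HG'.
    assert (HY : subset Y (adjoin Z a)).
    { intros x Hx. apply Hsub, in_adjoin. auto. }
    assert (R : forall T, ~ a ∈ T -> sep T (fun x => x <> a) = T).
    { intros T HT. apply set_ext. intro x. rewrite in_sep by definability.
      split; [tauto|]. intro Hx. split; [exact Hx|]. intros ->. tauto. }
    destruct (classic (b = a)) as [->|Nb].
    + assert (E : sep (adjoin Y a) (fun x => x <> a) = Y).
      { rewrite <- (R Y Hb) at 2. apply set_ext. intro x. rewrite !in_sep by definability.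
        rewrite in_adjoin. tauto. }
      rewrite E. pose proof (proj2 (in_adjoin Y a a) (or_intror eq_refl)). tauto.
    + assert (E : sep (adjoin Y b) (fun x => x <> a) = adjoin (sep Y (fun x => x <> a)) b).
      { apply set_ext. intro x. rewrite in_sep by definability.
        rewrite !in_adjoin, in_sep by definability.
        split; [tauto|]. intros [H| ->]; [tauto|auto]. }
      rewrite E.
      assert (Ea : a ∈ adjoin Y b <-> a ∈ Y).
      { rewrite in_adjoin. split; [intros [H|H]; [exact H|congruence]|auto]. }
      rewrite Ea.
      assert (W : adjoin (sep Y (fun x => x <> a)) b ∈ G <-> ~ sep Y (fun x => x <> a) ∈ G).
      { apply HG; [|rewrite in_sep by definability; tauto].
        intros x Hx. rewrite in_adjoin, in_sep in Hx by definability.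
        assert (Hxa : x <> a) by (destruct Hx as [Hx| ->]; [tauto|exact Nb]).
        assert (Hx' : x ∈ adjoin Y b) by (apply in_adjoin; tauto).
        apply Hsub in Hx'. apply in_adjoin in Hx'. tauto. }
      destruct (classic (a ∈ Y)) as [Ha|Ha]; [tauto|]. rewrite (R Y Ha) in W. tauto.
Qed.

Lemma alternating_unique G G' Z Z' Y : finite Y -> alternating G Z -> alternating G' Z' ->
  subset Y Z -> subset Y Z' -> (Y ∈ G <-> Y ∈ G').
Proof.
  intros HY [HG0 HG] [HG0' HG'].
  apply (finite_ind (P := fun Y => subset Y Z -> subset Y Z' -> (Y ∈ G <-> Y ∈ G')));
    [definability|tauto| |exact HY].
  intros s a _ Ha IH H1 H2. rewrite HG, HG' by assumption.
  rewrite IH; [tauto| |]; intros x Hx; [apply H1|apply H2]; apply in_adjoin; auto.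
Qed.

Lemma even_set_adjoin Y a : finite Y -> ~ a ∈ Y -> (even_set (adjoin Y a) <-> ~ even_set Y).
Proof.
  intros HY Ha. destruct (alternating_exists (finite_adjoin a HY)) as (G & HG).
  assert (S1 : forall x, subset x x) by (intros x y Hy; exact Hy).
  assert (S2 : subset Y (adjoin Y a)) by (intros x Hx; apply in_adjoin; auto).
  assert (E1 : even_set (adjoin Y a) <-> adjoin Y a ∈ G).
  { split; [|intro H; exists G; auto]. intros (G' & HG' & H).
    apply (alternating_unique (finite_adjoin a HY) HG HG'); auto. }
  assert (E2 : even_set Y <-> Y ∈ G).
  { split.
    - intros (G' & HG' & H). apply (alternating_unique HY HG HG'); auto.
    - intro H. exists G. split; [|exact H]. destruct HG as [H0 H1]. split; [exact H0|].
      intros T b HT Hb. apply H1; [|exact Hb]. intros x Hx. apply S2, HT, Hx. }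
  rewrite E1, E2. apply HG; auto.
Qed.

Lemma definable_even_set : definable1 even_set.
Proof. unfold even_set, alternating. definability. Qed.

(** * Towers *)

(** The iterates of [N] on [base]. As the least family closed under [N] they form a
    definable class, and no recursion on the natural numbers of the model is needed. *)
Definition tower (base : M) (N : M -> M) s : Prop :=
  forall g, base ∈ g -> (forall t, t ∈ g -> N t ∈ g) -> s ∈ g.

Section Tower.

Context (B base : M) (N : M -> M) (dN : definable_fun1 N) (base_sub : subset base B)
  (N_sub : forall t, subset t B -> subset (N t) B)
  (N_infl : forall t, subset t B -> subset t (N t))
  (N_mono : forall t t', subset t t' -> subset t' B -> subset (N t) (N t')).

Lemma definable_tower : definable1 (tower base N).
Proof. unfold tower. definability. Qed.
Local Hint Resolve definable_tower : definability.

Lemma tower_base : tower base N base.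
Proof. intros g H _. exact H. Qed.

Lemma tower_step t : tower base N t -> tower base N (N t).
Proof. intros H g H1 H2. apply H2, H; assumption. Qed.

Lemma tower_ind (P : M -> Prop) : definable1 P -> P base ->
  (forall t, tower base N t -> subset t B -> P t -> P (N t)) ->
  forall s, tower base N s -> P s.
Proof.
  intros HP H0 HS s Hs.
  assert (K : s ∈ sep (power B) (fun t => tower base N t /\ P t)).
  { apply Hs.
    - rewrite in_sep by definability. rewrite in_power. auto using tower_base.
    - intros t Ht. rewrite in_sep in * by definability. rewrite in_power in *.
      destruct Ht as (H1 & H2 & H3). auto using tower_step. }
  rewrite in_sep in K by definability. tauto.
Qed.

Lemma tower_sub s : tower base N s -> subset s B.
Proof.
  apply (tower_ind (P := fun s => subset s B)); [definability|exact base_sub|].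
  intros t _ Ht _. apply N_sub, Ht.
Qed.

(** As [N] is monotone, two successors are compared by comparing their predecessors, so a
    double induction suffices. *)
Lemma tower_chain t s : tower base N t -> tower base N s -> subset t s \/ subset s t.
Proof.
  assert (base_min : forall s, tower base N s -> subset base s).
  { apply (tower_ind (P := fun s => subset base s)); [definability|intros x Hx; exact Hx|].
    intros r _ Hr IH x Hx. apply N_infl; auto. }
  assert (cases : forall s, tower base N s ->
    s = base \/ exists r, tower base N r /\ s = N r).
  { apply (tower_ind (P := fun s => s = base \/ exists r, tower base N r /\ s = N r));
      [definability|auto|]. intros r Hr _ _. right. eauto. }
  intro Ht. revert s. revert t Ht.
  apply (tower_ind (P := fun t => forall s, tower base N s -> subset t s \/ subset s t)).
  - definability.
  - intros s Hs. left. apply base_min, Hs.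
  - intros t Ht HtB IH s Hs. destruct (cases s Hs) as [->|(r & Hr & ->)].
    + right. apply base_min, tower_step, Ht.
    + destruct (IH r Hr) as [K|K]; [left|right]; apply N_mono; auto using tower_sub.
Qed.

End Tower.

End FiniteClasses.

#[export] Hint Resolve definable_even_set : definability.

(** * Equivalence relations and chains on a strictly amorphous set *)

Section Amorphous.

Context {M : zf_model} (A : M) (hA : strictly_amorphous A).
Implicit Types (B C G K W Y Z a b c e f i p s t u v w x y z : M).

Lemma amorphous_infinite : ~ finite_class (fun a => a ∈ A).
Proof. rewrite finite_class_set. apply hA. Qed.

Lemma amorphous_split (P : M -> Prop) : definable1 P ->
  finite_class (fun a => a ∈ A /\ P a) \/ finite_class (fun a => a ∈ A /\ ~ P a).
Proof.
  intro HP. apply NNPP. intro H. apply (proj2 (proj1 hA)).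
  exists (sep A P), (sep A (fun a => ~ P a)).
  split; [|split; [|split]].
  - intro x. rewrite !in_sep by definability. tauto.
  - intros (x & Hx). rewrite !in_sep in Hx by definability. tauto.
  - intro K. apply H. left. apply finite_class_set in K. refine (finite_class_sub _ (K)).
    intro x. rewrite in_sep by definability. tauto.
  - intro K. apply H. right. apply finite_class_set in K. refine (finite_class_sub _ (K)).
    intro x. rewrite in_sep by definability. tauto.
Qed.

Lemma infinite_not_covered (P Q : M -> Prop) :
  ~ finite_class P -> finite_class Q -> exists a, P a /\ ~ Q a.
Proof.
  intros HP HQ. apply NNPP. intro H. apply HP. refine (finite_class_sub _ (HQ)).
  intros x Hx. apply NNPP. intro K. apply H. eauto.
Qed.

Lemma ex_fresh s : finite s -> exists a, a ∈ A /\ ~ a ∈ s.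
Proof. intro Hs. apply (infinite_not_covered amorphous_infinite). apply finite_class_set, Hs. Qed.

(** The finite classes with at least two points are among the finitely many nontrivial
    blocks of a partition of [A]. *)
Lemma equivalence_trivial (E : M -> M -> Prop) : definable2 E ->
  (forall a, a ∈ A -> E a a) ->
  (forall a b, a ∈ A -> b ∈ A -> E a b -> E b a) ->
  (forall a b c, a ∈ A -> b ∈ A -> c ∈ A -> E a b -> E b c -> E a c) ->
  finite_class (fun a => a ∈ A /\ (exists b, b ∈ A /\ b <> a /\ E a b) /\
                 finite_class (fun b => b ∈ A /\ E a b)).
Proof.
  intros HE Hr Hs Ht.
  set (P := sep (power A) (fun c => exists a, a ∈ A /\ c = sep A (fun b => E a b))).
  assert (HP : forall c, c ∈ P <-> exists a, a ∈ A /\ c = sep A (fun b => E a b)).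
  { intro c. unfold P. rewrite in_sep by definability. split; [tauto|].
    intro H. split; [|exact H]. destruct H as (a & _ & ->). apply in_power.
    intros x Hx. rewrite in_sep in Hx by definability. tauto. }
  clearbody P.
  destruct (proj2 hA P) as (N & HN & FN).
  - split; [|split].
    + intros c Hc. apply HP in Hc as (a & Ha & ->). split.
      * intros x Hx. rewrite in_sep in Hx by definability. tauto.
      * intro H. apply (H a). rewrite in_sep by definability. auto.
    + intros a Ha. exists (sep A (fun b => E a b)). split; [apply HP; eauto|].
      rewrite in_sep by definability. auto.
    + intros b c Hb Hc (a & H1 & H2).
      apply HP in Hb as (b' & Hb' & ->), Hc as (c' & Hc' & ->).
      rewrite in_sep in H1, H2 by definability.
      apply set_ext. intro x. rewrite !in_sep by definability.
      destruct H1 as [H1 H1'], H2 as [H2 H2'].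
      split; intros [Hx K]; split; auto.
      * apply (Ht c' a x); auto. apply (Ht a b' x); auto.
      * apply (Ht b' a x); auto. apply (Ht a c' x); auto.
  - apply (finite_class_sub (Q := fun a => exists c, c ∈ N /\ finite c /\ a ∈ c)).
    + intros a (Ha & (b & Hb & Nb & Hab) & HF). exists (sep A (fun b => E a b)).
      split; [|split].
      * apply HN. split; [apply HP; eauto|]. intros (d & Hd).
        assert (a = d) by (apply Hd; rewrite in_sep by definability; auto).
        assert (b = d) by (apply Hd; rewrite in_sep by definability; auto). congruence.
      * apply finite_class_set. refine (finite_class_sub _ (HF)). intros x Hx.
        rewrite in_sep in Hx by definability. exact Hx.
      * rewrite in_sep by definability. auto.
    + apply (finite_class_Union (P := fun c a => finite c /\ a ∈ c)); [definability|exact FN|].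
      intros c _. destruct (classic (finite c)) as [Hc|Hc].
      * apply (finite_class_sub (Q := fun x => x ∈ c)); [tauto|]. apply finite_class_set, Hc.
      * apply finite_class_unique. tauto.
Qed.

(** Suppose the union is infinite. Points contained in the same members of the chain form
    finite classes, nearly all of them singletons; let [J] consist of these singletons. The
    chain orders [J] linearly with finite initial segments [below j]. The parity of [below j]
    changes from a point to the next one, so neither parity can occur only finitely often,
    and [A] is split into two infinite parts. *)
Lemma chain_union (C : M -> Prop) : definable1 C ->
  (forall c, C c -> finite c /\ subset c A) ->
  (forall c d, C c -> C d -> subset c d \/ subset d c) ->
  finite_class (fun a => exists c, C c /\ a ∈ c).
Proof.
  intros HC Hfin Hchain.
  set (E := fun a b => forall c, C c -> (a ∈ c <-> b ∈ c)).
  set (J := fun a => a ∈ A /\ (exists c, C c /\ a ∈ c) /\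
                     forall b, b ∈ A -> E a b -> b = a).
  set (lt := fun a b => exists c, C c /\ a ∈ c /\ ~ b ∈ c).
  assert (dE : definable2 E) by (unfold E; definability).
  assert (dJ : definable1 J) by (unfold J; definability).
  assert (dlt : definable2 lt) by (unfold lt; definability).
  set (below := fun b => sep A (fun a => J a /\ lt a b)).
  assert (dbelow : definable_fun1 below) by (unfold below; definability).
  assert (Hbelow : forall a b, a ∈ below b <-> J a /\ lt a b).
  { intros a b. unfold below. rewrite in_sep by definability. unfold J. tauto. }
  clearbody below.
  apply NNPP. intro Hinf.
  assert (J_inf : ~ finite_class J).
  { intro HJ. apply Hinf.
    assert (T : finite_class (fun a => a ∈ A /\ (exists b, b ∈ A /\ b <> a /\ E a b) /\
                 finite_class (fun b => b ∈ A /\ E a b))).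
    { apply equivalence_trivial; [exact dE| | |]; unfold E.
      - tauto.
      - intros a b _ _ H c Hc. rewrite (H c Hc). tauto.
      - intros a b d _ _ _ H H' c Hc. rewrite (H c Hc). apply H', Hc. }
    refine (finite_class_sub _ (finite_class_or HJ T)).
    intros a (c & Hc & Hac). pose proof (Hfin c Hc) as [Fc Sc].
    destruct (classic (J a)) as [|Na]; [auto|right].
    assert (Ha : a ∈ A) by auto.
    split; [exact Ha|]. split.
    - apply NNPP. intro N. apply Na. split; [exact Ha|]. split; [eauto|].
      intros b Hb HE. apply NNPP. intro. apply N. eauto.
    - exists c. split; [exact Fc|]. intros b [_ Hb]. apply (Hb c Hc), Hac. }
  assert (lt_total : forall a b, J a -> J b -> a <> b -> lt a b \/ lt b a).
  { intros a b Ha Hb N. apply NNPP. intro H. apply N. symmetry.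
    apply Ha; [apply Hb|]. intros c Hc. split; intro K; apply NNPP; intro L; apply H.
    - left. exists c. auto.
    - right. exists c. auto. }
  assert (lt_asym : forall a b, lt a b -> lt b a -> False).
  { intros a b (c & Hc & H1 & H2) (d & Hd & H3 & H4).
    destruct (Hchain c d Hc Hd) as [S|S]; auto. }
  assert (lt_trans : forall a b d, lt a b -> lt b d -> lt a d).
  { intros a b e (c & Hc & H1 & H2) (d & Hd & H3 & H4).
    destruct (Hchain c d Hc Hd) as [S|S]; [|destruct (H2 (S _ H3))].
    exists d. auto. }
  assert (below_fin : forall b, J b -> finite (below b)).
  { intros b (_ & (c & Hc & Hbc) & _). apply (finite_sub (proj1 (Hfin c Hc))).
    intros a Ha. apply Hbelow in Ha as (_ & d & Hd & H1 & H2).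
    destruct (Hchain c d Hc Hd) as [S|S]; [|auto]. destruct (H2 (S _ Hbc)). }
  assert (least : forall Q : M -> Prop, definable1 Q -> (forall a, Q a -> J a) ->
    (exists a, Q a) -> exists a, Q a /\ forall b, Q b -> ~ lt b a).
  { intros Q HQ QJ (a & Ha).
    destruct (finite_min (P := fun Y => exists i, Q i /\ Y = below i) (s := below a))
      as (Y & _ & (i & Hi & ->) & Hmin); [definability|auto|eauto|].
    exists i. split; [exact Hi|]. intros b Hb L.
    assert (W : below b = below i).
    { apply Hmin; [|eauto]. intros x Hx. apply Hbelow in Hx as [H1 H2].
      apply Hbelow. eauto. }
    assert (W' : b ∈ below b) by (rewrite W; apply Hbelow; auto).
    apply Hbelow in W' as [_ W']. eauto. }
  (* A finite part of [J] is bounded, so it misses two consecutive points. *)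
  assert (escape : forall Q : M -> Prop, definable1 Q -> (forall a, Q a -> J a) -> finite_class Q ->
    exists j j', J j /\ J j' /\ ~ Q j /\ ~ Q j' /\ ~ j ∈ below j /\
      below j' = adjoin (below j) j).
  { intros Q HQ QJ (q & Fq & Hq).
    destruct (@infinite_not_covered J
      (fun a => exists b, b ∈ q /\ Q b /\ (a = b \/ a ∈ below b)))
      as (j & Jj & Hj).
    - exact J_inf.
    - apply (finite_class_Union (P := fun b a => Q b /\ (a = b \/ a ∈ below b)));
        [definability|exact Fq|]. intros b _. destruct (classic (Q b)) as [Qb|Qb].
      + apply (finite_class_sub (Q := fun a => a = b \/ a ∈ below b)); [tauto|].
        apply finite_class_or; [apply finite_class_one|apply finite_class_set; auto].
      + apply finite_class_unique. tauto.
    - assert (above : forall b, Q b -> lt b j).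
      { intros b Hb. apply NNPP. intro N. apply Hj. exists b. split; [auto|].
        split; [exact Hb|]. destruct (classic (j = b)) as [|Nb]; [auto|right].
        apply Hbelow. split; [exact Jj|]. destruct (lt_total j b); tauto || auto. }
      destruct (least (fun i => J i /\ lt j i)) as (j' & [Jj' Hj'] & Hmin).
      + definability.
      + tauto.
      + destruct (@infinite_not_covered J (fun a => a = j \/ a ∈ below j)) as (i & Ji & Hi).
        * exact J_inf.
        * apply finite_class_or; [apply finite_class_one|apply finite_class_set; auto].
        * exists i. split; [exact Ji|].
          destruct (lt_total i j) as [L|L]; [exact Ji|exact Jj|tauto| |exact L].
          destruct Hi. right. apply Hbelow. auto.
      + exists j, j'. split; [exact Jj|]. split; [exact Jj'|].
        assert (irr : forall x, ~ lt x x) by (intros x Hx; exact (lt_asym _ _ Hx Hx)).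
        split; [intro H; exact (irr _ (above _ H))|].
        split; [intro H; exact (lt_asym _ _ Hj' (above _ H))|].
        split; [intro H; apply Hbelow in H as [_ H]; exact (irr _ H)|].
        apply set_ext. intro x. rewrite in_adjoin, !Hbelow. split.
        * intros [Jx Lx]. destruct (classic (x = j)) as [|Nx]; [auto|left].
          split; [exact Jx|]. destruct (lt_total x j) as [L|L]; auto.
          destruct (Hmin x); auto.
        * intros [[Jx Lx]| ->]; eauto. }
  set (T := fun a => even_set (below a)).
  assert (dT : definable1 T) by (unfold T; definability).
  destruct (amorphous_split dT) as [H|H].
  - destruct (escape (fun a => J a /\ T a)) as (j & j' & Jj & Jj' & Qj & Qj' & Nj & Ej).
    + definability.
    + tauto.
    + refine (finite_class_sub _ (H)). unfold J. tauto.
    + unfold T in *. rewrite Ej in Qj'. pose proof (even_set_adjoin (below_fin j Jj) Nj). tauto.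
  - destruct (escape (fun a => J a /\ ~ T a)) as (j & j' & Jj & Jj' & Qj & Qj' & Nj & Ej).
    + definability.
    + tauto.
    + refine (finite_class_sub _ (H)). unfold J. tauto.
    + unfold T in *. rewrite Ej in Qj'. pose proof (even_set_adjoin (below_fin j Jj) Nj). tauto.
Qed.

(** * Finite subsets by size *)

Definition enlarge K : M :=
  sep (power A) (fun x => x ∈ K \/ exists y a, y ∈ K /\ a ∈ A /\ x = adjoin y a).

(** The stages of this tower are the families of all subsets of [A] with at most [k]
    elements. They stand for the number [k] in inductions on size. *)
Definition level : M -> Prop := tower (adjoin empty empty) enlarge.

Lemma term_enlarge : definable_fun1 enlarge.
Proof. unfold enlarge. definability. Qed.
Local Hint Resolve term_enlarge : definability.

Lemma definable_level : definable1 level.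
Proof. apply definable_tower. definability. Qed.
Local Hint Resolve definable_level : definability.

Lemma in_enlarge K x : subset K (power A) ->
  x ∈ enlarge K <-> x ∈ K \/ exists y a, y ∈ K /\ a ∈ A /\ x = adjoin y a.
Proof.
  intro HK. unfold enlarge. rewrite in_sep by definability. split; [tauto|].
  intro H. split; [|exact H]. destruct H as [H|(y & a & Hy & Ha & ->)]; [auto|].
  apply in_power. intros x Hx. apply in_adjoin in Hx as [Hx| ->]; [|exact Ha].
  apply HK in Hy. apply in_power in Hy. auto.
Qed.

Lemma level_base_sub : subset (adjoin empty empty) (power A).
Proof.
  intros x Hx. apply in_adjoin in Hx as [Hx| ->]; [destruct (in_empty Hx)|].
  apply in_power. intros y Hy. destruct (in_empty Hy).
Qed.

Lemma enlarge_sub K : subset K (power A) -> subset (enlarge K) (power A).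
Proof. intros _ x Hx. unfold enlarge in Hx. rewrite in_sep in Hx by definability. tauto. Qed.

Lemma level_ind (P : M -> Prop) : definable1 P -> P (adjoin empty empty) ->
  (forall K, level K -> subset K (power A) -> P K -> P (enlarge K)) ->
  forall K, level K -> P K.
Proof. apply tower_ind; [definability|exact level_base_sub|exact enlarge_sub]. Qed.

Lemma level_sub K : level K -> subset K (power A).
Proof. apply tower_sub; [definability|exact level_base_sub|exact enlarge_sub]. Qed.

Lemma level_enlarge K : level K -> level (enlarge K).
Proof. apply tower_step. Qed.

Lemma level_incl K : level K -> subset K (enlarge K).
Proof. intros HK x Hx. apply in_enlarge; [apply level_sub, HK|auto]. Qed.

Lemma level_chain K K' : level K -> level K' -> subset K K' \/ subset K' K.
Proof.
  apply (tower_chain (B := power A)); [definability|exact level_base_sub|exact enlarge_sub| |].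
  - intros t Ht x Hx. apply in_enlarge; auto.
  - intros t t' H H' x Hx. apply in_enlarge; [exact H'|].
    apply in_enlarge in Hx; [|intros y Hy; auto].
    destruct Hx as [Hx|(y & a & Hy & Ha & ->)]; eauto 8.
Qed.

Lemma level_cover x : finite x -> subset x A -> exists K, level K /\ x ∈ K.
Proof.
  apply (finite_ind (P := fun x => subset x A -> exists K, level K /\ x ∈ K)); [definability| |].
  - intros _. exists (adjoin empty empty). split; [apply tower_base|apply in_adjoin; auto].
  - clear x. intros x a _ _ IH H. destruct IH as (K & HK & Hx).
    { intros y Hy. apply H, in_adjoin. auto. }
    exists (enlarge K). split; [apply level_enlarge, HK|].
    apply in_enlarge; [apply level_sub, HK|]. right. exists x, a.
    split; [exact Hx|]. split; [apply H, in_adjoin; auto|reflexivity].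
Qed.

(** A proper subset of a set with at most [k + 1] elements has at most [k] elements. *)
Lemma level_proper K x y : level K -> x ∈ enlarge K -> subset y x -> y <> x -> y ∈ K.
Proof.
  intro HK. revert x y.
  apply (level_ind (P := fun K => forall x y, x ∈ enlarge K -> subset y x -> y <> x ->
    y ∈ K)); [definability| | |exact HK].
  - intros x y Hx Hyx N. apply in_adjoin. right.
    apply in_enlarge in Hx; [|exact level_base_sub].
    apply is_emptyE. intros z Hz. pose proof (Hyx z Hz) as Hzx.
    destruct Hx as [Hx|(e & a & He & _ & ->)].
    + apply in_adjoin in Hx as [Hx| ->]; [exact (in_empty Hx)|exact (in_empty Hzx)].
    + apply in_adjoin in He as [He| ->]; [exact (in_empty He)|].
      apply N. apply set_ext. intro w. split; [apply Hyx|]. intro Hw.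
      apply in_adjoin in Hw as [Hw| ->]; [destruct (in_empty Hw)|].
      apply in_adjoin in Hzx as [Hzx| ->]; [destruct (in_empty Hzx)|exact Hz].
  - clear K HK. intros K HK SK IH x y Hx Hyx N.
    pose proof (level_incl HK) as Inc.
    apply in_enlarge in Hx; [|apply enlarge_sub, SK].
    destruct Hx as [Hx|(z & a & Hz & Ha & ->)]; [apply Inc; eauto|].
    destruct (classic (a ∈ z)) as [Haz|Haz].
    { rewrite (adjoin_mem Haz) in *. apply Inc. eauto. }
    set (y' := sep y (fun w => w <> a)).
    assert (Hy' : forall w, w ∈ y' <-> w ∈ y /\ w <> a)
      by (intro w; unfold y'; rewrite in_sep by definability; tauto).
    assert (S : subset y' z).
    { intros w Hw. apply Hy' in Hw as [Hw Nw]. apply Hyx in Hw.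
      apply in_adjoin in Hw. tauto. }
    destruct (classic (a ∈ y)) as [Hay|Hay].
    + assert (E : y = adjoin y' a).
      { apply set_ext. intro w. rewrite in_adjoin, Hy'.
        destruct (classic (w = a)) as [->|]; tauto. }
      rewrite E. apply in_enlarge; [exact SK|]. right. exists y', a.
      split; [|auto]. apply (IH z); [exact Hz|exact S|]. intros E'. apply N.
      rewrite E, E'. reflexivity.
    + assert (E : y = y').
      { apply set_ext. intro w. rewrite Hy'. split; [|tauto]. intro Hw. split; [exact Hw|].
        intros ->. tauto. }
      rewrite <- E in S. destruct (classic (y = z)) as [->|]; [exact Hz|].
      apply Inc. eauto.
Qed.

(** In the induction step take two disjoint sets [W] and [W'], both too large for [K].
    If [adjoin z a] contained their union, then [z] would contain one of them, namely one
    without [a]. *)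
Lemma level_exceeded K : level K -> forall D, ~ finite D ->
  exists W, finite W /\ subset W D /\ forall y, y ∈ K -> ~ subset W y.
Proof.
  revert K. apply (level_ind (P := fun K => forall D, ~ finite D ->
    exists W, finite W /\ subset W D /\ forall y, y ∈ K -> ~ subset W y)); [definability| |].
  - intros D HD. destruct (classic (exists d, d ∈ D)) as [(d & Hd)|N].
    + exists (adjoin empty d). split; [apply finite_adjoin, finite_empty|]. split.
      * intros x Hx. apply in_adjoin in Hx as [Hx| ->]; [destruct (in_empty Hx)|exact Hd].
      * intros y Hy S. apply in_adjoin in Hy as [Hy| ->]; [exact (in_empty Hy)|].
        apply (@in_empty M d), S, in_adjoin. auto.
    + destruct HD. apply finite_class_set, finite_class_unique. intros x y Hx. destruct N. eauto.
  - intros K _ SK IH D HD.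
    destruct (IH D HD) as (W & FW & SW & HW).
    set (D' := sep D (fun x => ~ x ∈ W)).
    assert (HD' : forall x, x ∈ D' <-> x ∈ D /\ ~ x ∈ W)
      by (intro x; unfold D'; rewrite in_sep by definability; tauto).
    destruct (IH D') as (W' & FW' & SW' & HW').
    { intro F. apply HD. apply finite_class_set. apply finite_class_set in F, FW.
      refine (finite_class_sub _ (finite_class_or F FW)). intros x Hx. rewrite HD'. tauto. }
    apply finite_class_set in FW, FW'. destruct (finite_class_or FW FW') as (V & FV & HV).
    set (V' := sep V (fun x => x ∈ W \/ x ∈ W')).
    assert (HV' : forall x, x ∈ V' <-> x ∈ W \/ x ∈ W').
    { intro x. unfold V'. rewrite in_sep by definability. split; [tauto|]. auto. }
    exists V'. split; [unfold V'; apply finite_sep; [definability|exact FV]|]. split.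
    + intros x Hx. apply HV' in Hx as [Hx|Hx]; [auto|]. apply SW' in Hx.
      apply HD' in Hx. tauto.
    + intros y Hy S. apply in_enlarge in Hy; [|exact SK].
      destruct Hy as [Hy|(z & a & Hz & _ & ->)].
      { apply (HW y Hy). intros x Hx. apply S, HV'. auto. }
      destruct (classic (a ∈ W)) as [Ha|Ha].
      * apply (HW' z Hz). intros x Hx. pose proof (S x) as Sx. rewrite HV', in_adjoin in Sx.
        destruct Sx as [|E]; [auto|auto|]. subst x. apply SW', HD' in Hx. tauto.
      * apply (HW z Hz). intros x Hx. pose proof (S x) as Sx. rewrite HV', in_adjoin in Sx.
        destruct Sx as [|E]; [auto|auto|]. subst x. tauto.
Qed.

(** * Locally finite relations *)

(** The component of [a] is the union of the balls around [a], which form a chain of finite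
    sets. So all components are finite, and almost all are singletons. *)
Lemma locally_finite_symmetric (S : M -> M -> Prop) : definable2 S ->
  (forall a b, S a b -> S b a) ->
  (forall a, a ∈ A -> finite_class (fun b => b ∈ A /\ S a b)) ->
  finite_class (fun a => a ∈ A /\ exists b, b ∈ A /\ b <> a /\ S a b).
Proof.
  intros dS Ssym Sfin.
  set (closed := fun t => forall x y, x ∈ t -> y ∈ A -> S x y -> y ∈ t).
  set (comp := fun a b => forall t, subset t A -> a ∈ t -> closed t -> b ∈ t).
  assert (dclosed : definable1 closed) by (unfold closed; definability).
  assert (dcomp : definable2 comp) by (unfold comp; definability).
  assert (comp_step : forall a b, a ∈ A -> b ∈ A -> S a b -> comp a b).
  { intros a b Ha Hb H t _ Hat Ht. exact (Ht a b Hat Hb H). }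
  assert (comp_sym : forall a b, a ∈ A -> b ∈ A -> comp a b -> comp b a).
  { intros a b Ha Hb H t St Hbt Ht. apply NNPP. intro N.
    assert (K : b ∈ sep A (fun x => ~ x ∈ t)).
    { apply H.
      - intros x Hx. rewrite in_sep in Hx by definability. tauto.
      - rewrite in_sep by definability. auto.
      - intros x y Hx Hy L. rewrite in_sep in * by definability. split; [exact Hy|].
        intro Hyt. destruct Hx as [Hx Nx]. apply Nx. apply (Ht y x); auto. }
    rewrite in_sep in K by definability. tauto. }
  assert (comp_fin : forall a, a ∈ A -> finite_class (fun b => b ∈ A /\ comp a b)).
  { intros a Ha.
    set (N := fun t => sep A (fun x => x ∈ t \/ exists y, y ∈ t /\ S y x)).
    assert (dN : definable_fun1 N) by (unfold N; definability).
    assert (HN : forall t x, x ∈ N t <-> x ∈ A /\ (x ∈ t \/ exists y, y ∈ t /\ S y x))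
      by (intros t x; unfold N; rewrite in_sep by definability; tauto).
    clearbody N.
    assert (base_sub : subset (adjoin empty a) A).
    { intros x Hx. apply in_adjoin in Hx as [Hx| ->]; [destruct (in_empty Hx)|exact Ha]. }
    assert (N_sub : forall t, subset t A -> subset (N t) A).
    { intros t _ x Hx. apply HN in Hx. tauto. }
    assert (N_infl : forall t, subset t A -> subset t (N t)).
    { intros t Ht x Hx. apply HN. auto. }
    assert (dB : definable1 (tower (adjoin empty a) N)) by (apply definable_tower; definability).
    assert (U : finite_class (fun b => exists c, tower (adjoin empty a) N c /\ b ∈ c)).
    { apply chain_union; [exact dB| |].
      - intros c Hc. split; [|apply (tower_sub dN base_sub N_sub Hc)].
        apply (tower_ind (B := A) (P := fun c => finite c) dN base_sub N_sub);
          [definability|apply finite_adjoin, finite_empty| |exact Hc].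
        intros t _ St Ft. apply finite_class_set.
        apply (finite_class_sub (Q := fun x => x ∈ t \/ exists y, y ∈ t /\ x ∈ A /\ S y x)).
        + intros x Hx. apply HN in Hx as (Hx & [H|(y & Hy & H)]); eauto.
        + apply finite_class_or; [apply finite_class_set, Ft|].
          apply (finite_class_Union (P := fun y x => x ∈ A /\ S y x));
            [definability|exact Ft|auto].
      - intros c d. apply (tower_chain dN base_sub N_sub N_infl).
        intros t t' H H' x Hx. apply HN in Hx. apply HN.
        destruct Hx as (Hx & [K|(y & Hy & K)]); split; auto; right; eauto. }
    set (V := sep A (fun b => exists c, tower (adjoin empty a) N c /\ b ∈ c)).
    assert (HV : forall b, b ∈ V <-> b ∈ A /\ exists c, tower (adjoin empty a) N c /\ b ∈ c)
      by (intro b; unfold V; rewrite in_sep by definability; tauto).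
    refine (finite_class_sub _ (U)). intros b [_ Hb]. apply HV, Hb.
    - intros x Hx. apply HV in Hx. tauto.
    - apply HV. split; [exact Ha|]. exists (adjoin empty a).
      split; [apply tower_base|apply in_adjoin; auto].
    - intros x y Hx Hy H. apply HV in Hx as (Hx & c & Hc & Hxc). apply HV.
      split; [exact Hy|]. exists (N c). split; [apply tower_step, Hc|].
      apply HN. split; [exact Hy|]. right. exists x. auto. }
  eapply finite_class_sub; [|apply (equivalence_trivial dcomp)].
  - intros a (Ha & b & Hb & Nb & H). split; [exact Ha|]. split; [|auto].
    exists b. auto.
  - intros a _ t _ H _. exact H.
  - exact comp_sym.
  - intros a b c Ha Hb Hc H H' t St Hat Ht. apply H'; auto.
Qed.

(** Let [E] be the set of points with infinitely, hence cofinitely, many predecessors.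
    If [E] were infinite, then for each [k] any [k + 1] points of [E] would have a common
    predecessor among almost all points, so only finitely many points could have at most [k]
    successors; these finite sets form a chain with union [A], which is impossible. Outside
    the finite set [E] predecessors are finite in number too, and
    the relation can be made symmetric. *)
Lemma locally_finite_image (R : M -> M -> Prop) : definable2 R ->
  (forall a, a ∈ A -> finite_class (fun b => b ∈ A /\ R a b)) ->
  finite_class (fun b => b ∈ A /\ exists a, a ∈ A /\ a <> b /\ R a b).
Proof.
  intros dR Rfin.
  set (E := fun b => ~ finite_class (fun a => a ∈ A /\ R a b)).
  assert (dE : definable1 E) by (unfold E, finite_class; definability).
  assert (E_fin : finite_class (fun b => b ∈ A /\ E b)).
  { apply NNPP. intro Einf.
    set (L := fun K => sep A (fun a => sep A (fun b => R a b) ∈ K)).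
    assert (HL : forall K a, a ∈ L K <-> a ∈ A /\ sep A (fun b => R a b) ∈ K)
      by (intros K a; unfold L; rewrite in_sep by definability; tauto).
    assert (dL : definable_fun1 L) by (unfold L; definability).
    clearbody L.
    destruct (classic (exists K, level K /\ ~ finite (L K))) as [(K & HK & Linf)|N].
    - destruct (level_exceeded HK (D := sep A E)) as (W & FW & SW & HW).
      { intro F. apply Einf. apply finite_class_set in F. refine (finite_class_sub _ (F)).
        intro x. rewrite in_sep by definability. tauto. }
      destruct (@infinite_not_covered (fun a => a ∈ L K)
        (fun a => exists w, w ∈ W /\ a ∈ A /\ ~ R a w))
        as (a & Ha & Na).
      + rewrite finite_class_set. exact Linf.
      + apply (finite_class_Union (P := fun w a => a ∈ A /\ ~ R a w)); [definability|exact FW|].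
        intros w Hw. apply SW in Hw. rewrite in_sep in Hw by definability.
        assert (dw : definable1 (fun a => R a w)) by definability.
        destruct (amorphous_split dw) as [H|H]; [|exact H]. destruct (proj2 Hw H).
      + apply HL in Ha as [Ha HaK]. apply (HW _ HaK). intros w Hw.
        pose proof (SW w Hw) as Hw'. rewrite in_sep in * by definability.
        split; [tauto|]. apply NNPP. intro NR. apply Na. eauto.
    - apply amorphous_infinite.
      assert (U : finite_class (fun a => exists c, (exists K, level K /\ c = L K) /\ a ∈ c)).
      { apply chain_union.
        - definability.
        - intros c (K & HK & ->). split.
          + apply NNPP. intro. apply N. eauto.
          + intros x Hx. apply HL in Hx. tauto.
        - intros c d (K & HK & ->) (K' & HK' & ->).
          destruct (level_chain HK HK') as [S|S]; [left|right];
            intros x Hx; apply HL in Hx as [Hx H]; apply HL; auto. }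
      refine (finite_class_sub _ (U)). intros a Ha.
      destruct (@level_cover (sep A (fun b => R a b))) as (K & HK & H).
      + apply finite_class_set. refine (finite_class_sub _ (Rfin a Ha)).
        intro x. rewrite in_sep by definability. tauto.
      + intros x Hx. rewrite in_sep in Hx by definability. tauto.
      + exists (L K). split; [eauto|]. apply HL. auto. }
  set (S := fun a b => ~ E a /\ ~ E b /\ (R a b \/ R b a)).
  assert (dS : definable2 S) by (unfold S; definability).
  assert (HS : finite_class (fun a => a ∈ A /\ exists b, b ∈ A /\ b <> a /\ S a b)).
  { apply locally_finite_symmetric; [exact dS|unfold S; tauto|].
    intros a Ha. destruct (classic (E a)) as [Ea|Ea].
    - apply finite_class_unique. unfold S. tauto.
    - apply (finite_class_sub (Q := fun b => (b ∈ A /\ R a b) \/ (b ∈ A /\ R b a)));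
        [unfold S; tauto|]. apply finite_class_or; [auto|apply NNPP, Ea]. }
  destruct E_fin as (e & Fe & He).
  assert (HU : finite_class (fun b => exists a, a ∈ e /\ a ∈ A /\ b ∈ A /\ R a b)).
  { apply (finite_class_Union (P := fun a b => a ∈ A /\ b ∈ A /\ R a b));
      [definability|exact Fe|].
    intros a _. destruct (classic (a ∈ A)) as [Ha|Ha].
    - refine (finite_class_sub _ (Rfin a Ha)). tauto.
    - apply finite_class_unique. tauto. }
  apply finite_class_set in Fe.
  refine (finite_class_sub _ (finite_class_or Fe (finite_class_or HS HU))).
  intros b (Hb & a & Ha & Nab & H).
  destruct (classic (E b)) as [Eb|Eb]; [auto|].
  destruct (classic (E a)) as [Ea|Ea]; right.
  - right. exists a. auto.
  - left. split; [exact Hb|]. exists a. unfold S. tauto.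
Qed.

Definition cup x y : M := union (upair x y).

Lemma in_cup x y z : z ∈ cup x y <-> z ∈ x \/ z ∈ y.
Proof.
  unfold cup. rewrite in_union. setoid_rewrite in_upair. split.
  - intros (w & [-> | ->] & H); auto.
  - intros [H|H]; eauto.
Qed.

Lemma term_cup : definable_fun2 cup.
Proof. unfold cup. definability. Qed.
Local Hint Resolve term_cup : definability.

(** Induction on the size of [y] in the statement for [R (cup y w)], with [w] an arbitrary
    finite set. To pass from [y] to [adjoin y a], move [a] into [w]: by induction this
    leaves, for each [a], finitely many values outside [adjoin w a], and
    [locally_finite_image] applies to the relation between [a] and these values. *)
Lemma closure_trivial (R : M -> M -> Prop) : definable2 R ->
  (forall x, finite x -> subset x A -> finite_class (fun u => u ∈ A /\ R x u)) ->
  finite_class (fun u => u ∈ A /\ exists x, finite x /\ subset x A /\ ~ u ∈ x /\ R x u).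
Proof.
  intros dR Rfin.
  assert (K0 : forall K, level K -> forall w, finite w -> subset w A ->
    finite_class (fun u => u ∈ A /\ exists y, y ∈ K /\ ~ u ∈ cup y w /\ R (cup y w) u)).
  { apply (level_ind (P := fun K => forall w, finite w -> subset w A ->
      finite_class (fun u => u ∈ A /\ exists y, y ∈ K /\ ~ u ∈ cup y w /\ R (cup y w) u))).
    - unfold finite_class. definability.
    - intros w Fw Sw. refine (finite_class_sub _ (Rfin w Fw Sw)).
      intros u (Hu & y & Hy & _ & H). split; [exact Hu|].
      apply in_adjoin in Hy as [Hy| ->]; [destruct (in_empty Hy)|].
      replace w with (cup empty w); [exact H|]. apply set_ext. intro z. rewrite in_cup.
      pose proof (@in_empty M z). tauto.
    - intros K HK SK IH w Fw Sw.
      set (R' := fun a u => exists y, y ∈ K /\ ~ u ∈ cup y (adjoin w a) /\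
                                      R (cup y (adjoin w a)) u).
      assert (H1 : finite_class (fun u => u ∈ A /\ exists a, a ∈ A /\ a <> u /\ R' a u)).
      { apply locally_finite_image; unfold R'; [definability|]. intros a Ha.
        apply IH; [apply finite_adjoin, Fw|].
        intros x Hx. apply in_adjoin in Hx as [Hx| ->]; auto. }
      refine (finite_class_sub _ (finite_class_or (IH w Fw Sw) H1)).
      intros u (Hu & y & Hy & Nu & H). apply in_enlarge in Hy; [|exact SK].
      destruct Hy as [Hy|(z & a & Hz & Ha & ->)]; [left; eauto|right].
      assert (E : cup (adjoin z a) w = cup z (adjoin w a)).
      { apply set_ext. intro x. rewrite !in_cup, !in_adjoin. tauto. }
      rewrite E in Nu, H. split; [exact Hu|]. exists a. split; [exact Ha|]. split.
      + intros ->. apply Nu, in_cup. right. apply in_adjoin. auto.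
      + exists z. auto. }
  set (U := fun K => sep A (fun u => exists y, y ∈ K /\ ~ u ∈ y /\ R y u)).
  assert (dU : definable_fun1 U) by (unfold U; definability).
  assert (HU : forall K u, u ∈ U K <-> u ∈ A /\ exists y, y ∈ K /\ ~ u ∈ y /\ R y u)
    by (intros K u; unfold U; rewrite in_sep by definability; tauto).
  clearbody U.
  assert (H : finite_class (fun u => exists c, (exists K, level K /\ c = U K) /\ u ∈ c)).
  { apply chain_union.
    - definability.
    - intros c (K & HK & ->). split; [|intros x Hx; apply HU in Hx; tauto].
      apply finite_class_set.
      assert (S0 : subset empty A) by (intros x Hx; destruct (in_empty Hx)).
      refine (finite_class_sub _ (K0 K HK empty finite_empty S0)).
      intros u Hu. apply HU in Hu as (Hu & y & Hy & H). split; [exact Hu|].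
      exists y. replace (cup y empty) with y; [tauto|].
      apply set_ext. intro x. rewrite in_cup. pose proof (@in_empty M x). tauto.
    - intros c d (K & HK & ->) (K' & HK' & ->).
      destruct (level_chain HK HK') as [S|S]; [left|right];
        intros x Hx; apply HU in Hx as (Hx & y & Hy & H); apply HU; eauto. }
  refine (finite_class_sub _ (H)). intros u (Hu & x & Fx & Sx & Hx).
  destruct (level_cover Fx Sx) as (K & HK & HxK).
  exists (U K). split; [eauto|]. apply HU. eauto.
Qed.

(** For each parameter [y] the property [H y] or its negation holds at finitely many points
    only. As each [s] supports finitely many [y], there are finitely many exceptional points
    for each [s], and [closure_trivial] confines them to [s] and a fixed finite set. *)
Lemma generic_constancy (Y H : M -> M -> Prop) : definable2 Y -> definable2 H ->
  (forall s, finite s -> subset s A -> finite_class (Y s)) ->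
  exists e, finite e /\ forall s y b c, finite s -> subset s A -> Y s y ->
    b ∈ A -> c ∈ A -> ~ b ∈ s -> ~ c ∈ s -> ~ b ∈ e -> ~ c ∈ e -> (H y b <-> H y c).
Proof.
  intros dY dH Yfin.
  set (R := fun s u => exists y, Y s y /\
    ((H y u /\ finite_class (fun b => b ∈ A /\ H y b)) \/
     (~ H y u /\ finite_class (fun b => b ∈ A /\ ~ H y b)))).
  destruct (@closure_trivial R) as (e & Fe & He).
  - unfold R, finite_class. definability.
  - intros s Fs Ss. destruct (Yfin s Fs Ss) as (t & Ft & Ht).
    set (P := fun y u => u ∈ A /\
      ((H y u /\ finite_class (fun b => b ∈ A /\ H y b)) \/
       (~ H y u /\ finite_class (fun b => b ∈ A /\ ~ H y b)))).
    apply (finite_class_sub (Q := fun u => exists y, y ∈ t /\ P y u)).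
    + intros u (Hu & y & Hy & K). exists y. unfold P. auto.
    + apply finite_class_Union; [unfold P, finite_class; definability|exact Ft|].
      intros y _. unfold P.
      apply (finite_class_sub (Q := fun u =>
        (u ∈ A /\ H y u /\ finite_class (fun b => b ∈ A /\ H y b)) \/
        (u ∈ A /\ ~ H y u /\ finite_class (fun b => b ∈ A /\ ~ H y b)))); [tauto|].
      apply finite_class_or.
      * destruct (classic (finite_class (fun b => b ∈ A /\ H y b))) as [F|F].
        -- refine (finite_class_sub _ (F)). tauto.
        -- apply finite_class_unique. tauto.
      * destruct (classic (finite_class (fun b => b ∈ A /\ ~ H y b))) as [F|F].
        -- refine (finite_class_sub _ (F)). tauto.
        -- apply finite_class_unique. tauto.
  - exists e. split; [exact Fe|].
    intros s y b c Fs Ss Hy Hb Hc Nb Nc Eb Ec.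
    assert (K : forall u, u ∈ A -> ~ u ∈ s -> ~ u ∈ e -> ~ R s u).
    { intros u Hu Nu Eu HR. apply Eu, He. split; [exact Hu|]. exists s. auto. }
    pose proof (K b Hb Nb Eb) as Kb. pose proof (K c Hc Nc Ec) as Kc.
    assert (dHy : definable1 (H y)) by definability.
    destruct (amorphous_split dHy) as [F|F].
    + assert (L : forall u, ~ R s u -> ~ H y u).
      { intros u Hu HH. apply Hu. exists y. auto. }
      pose proof (L b Kb). pose proof (L c Kc). tauto.
    + assert (L : forall u, ~ R s u -> H y u).
      { intros u Hu. apply NNPP. intro HH. apply Hu. exists y. auto. }
      pose proof (L b Kb). pose proof (L c Kc). tauto.
Qed.

End Amorphous.

#[export] Hint Resolve term_cup term_enlarge definable_level : definability.

(** * Colourings by subsets of a finite set *)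

Section Colourings.

Context {M : zf_model} (A : M) (hA : strictly_amorphous A) (n : M) (hn : finite n)
  (X : M) (hX : forall x, x ∈ X <-> is_function x n (power A)).
Implicit Types (B C D K W Y Z a b c d e f i j p s t u v w x y z : M).

Definition same_colour x a b : Prop := forall i, i ∈ n -> (a ∈ app x i <-> b ∈ app x i).

Definition supported x s : Prop := forall a b, a ∈ A -> b ∈ A -> ~ a ∈ s -> ~ b ∈ s ->
  same_colour x a b.

Lemma definable_same_colour : definable3 same_colour.
Proof. unfold same_colour. definability. Qed.
Local Hint Resolve definable_same_colour : definability.

Lemma definable_supported : definable2 supported.
Proof. unfold supported. definability. Qed.
Local Hint Resolve definable_supported : definability.

Lemma app_sub x i a : x ∈ X -> i ∈ n -> a ∈ app x i -> a ∈ A.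
Proof.
  intros Hx Hi Ha. apply hX in Hx. pose proof (function_maps Hx Hi) as [_ H].
  apply in_power in H. auto.
Qed.

Lemma colouring_ext x y : x ∈ X -> y ∈ X ->
  (forall a i, a ∈ A -> i ∈ n -> (a ∈ app x i <-> a ∈ app y i)) -> x = y.
Proof.
  intros Hx Hy H. apply (function_ext (A := n) (B := power A)); try (apply hX; assumption).
  intros i Hi. apply set_ext. intro a.
  split; intro Ha; apply H; eauto using app_sub; apply H; eauto using app_sub.
Qed.

Definition colouring (Q : M -> M -> Prop) : M :=
  graph n (power A) (fun i v => forall c, c ∈ v <-> c ∈ A /\ Q i c).

Lemma colouring_spec Q : definable2 Q -> colouring Q ∈ X /\
  forall i c, i ∈ n -> c ∈ A -> (c ∈ app (colouring Q) i <-> Q i c).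
Proof.
  intro dQ.
  assert (dG : definable2 (fun i v => forall c, c ∈ v <-> c ∈ A /\ Q i c)) by definability.
  assert (K : is_function (colouring Q) n (power A)).
  { apply graph_function; [exact dG|]. intros i Hi. exists (sep A (Q i)).
    assert (HS : forall c, c ∈ sep A (Q i) <-> c ∈ A /\ Q i c)
      by (intro c; apply in_sep; definability).
    split; [apply in_power; intros c Hc; apply HS in Hc; tauto|]. split; [exact HS|].
    intros v _ Hv. apply set_ext. intro c. rewrite HS, Hv. tauto. }
  split; [apply hX, K|]. intros i c Hi Hc.
  pose proof (function_maps K Hi) as [H _]. apply pair_in_graph in H; [|exact dG].
  destruct H as (_ & _ & H). rewrite H. tauto.
Qed.

Lemma support_exists x : x ∈ X -> exists s, finite s /\ subset s A /\ supported x s.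
Proof.
  intro Hx.
  set (P := fun i u => u ∈ A /\
    ((u ∈ app x i /\ finite_class (fun b => b ∈ A /\ b ∈ app x i)) \/
     (~ u ∈ app x i /\ finite_class (fun b => b ∈ A /\ ~ b ∈ app x i)))).
  assert (H : finite_class (fun u => exists i, i ∈ n /\ P i u)).
  { apply finite_class_Union; [unfold P, finite_class; definability|exact hn|].
    intros i _. unfold P.
    apply (finite_class_sub (Q := fun u =>
        (u ∈ A /\ u ∈ app x i /\ finite_class (fun b => b ∈ A /\ b ∈ app x i)) \/
        (u ∈ A /\ ~ u ∈ app x i /\ finite_class (fun b => b ∈ A /\ ~ b ∈ app x i))));
      [tauto|].
    apply finite_class_or.
    - destruct (classic (finite_class (fun b => b ∈ A /\ b ∈ app x i))) as [F|F].
      + refine (finite_class_sub _ F). tauto.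
      + apply finite_class_unique. tauto.
    - destruct (classic (finite_class (fun b => b ∈ A /\ ~ b ∈ app x i))) as [F|F].
      + refine (finite_class_sub _ F). tauto.
      + apply finite_class_unique. tauto. }
  destruct H as (s & Fs & Hs). exists (sep s (fun a => a ∈ A)).
  split; [apply finite_sep; [definability|exact Fs]|].
  split; [intros a Ha; rewrite in_sep in Ha by definability; tauto|].
  intros a b Ha Hb Na Nb i Hi. rewrite in_sep in Na, Nb by definability.
  assert (L : forall u, u ∈ A -> ~ u ∈ s -> ~ P i u).
  { intros u Hu Nu HP. apply Nu, Hs. eauto. }
  pose proof (L a Ha) as La. pose proof (L b Hb) as Lb. unfold P in La, Lb.
  assert (d : definable1 (fun u => u ∈ app x i)) by definability.
  destruct (amorphous_split hA d); tauto.
Qed.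

(** Such a colouring is determined by its restriction to [s] and one further point [e],
    which is coded by a subset of the finite set [prod (adjoin s e) n]. *)
Lemma finitely_many_supported s : finite s -> finite_class (fun x => x ∈ X /\ supported x s).
Proof.
  intro Fs. destruct (ex_fresh hA Fs) as (e & He & Ne).
  set (V := prod (adjoin s e) n).
  assert (FV : finite (power V))
    by (apply finite_power, finite_prod; [apply finite_adjoin, Fs|exact hn]).
  set (P := fun y x => x ∈ X /\ supported x s /\
    forall a i, a ∈ adjoin s e -> i ∈ n -> (a ∈ app x i <-> pair a i ∈ y)).
  apply (finite_class_sub (Q := fun x => exists y, y ∈ power V /\ P y x)).
  - intros x [Hx Sx]. exists (sep V (fun p => exists a i, p = pair a i /\ a ∈ app x i)).
    split; [apply in_power; intros p Hp; rewrite in_sep in Hp by definability; tauto|].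
    split; [exact Hx|]. split; [exact Sx|]. intros a i Ha Hi. rewrite in_sep by definability.
    unfold V. rewrite pair_in_prod. split; [eauto 6|].
    intros (_ & a' & i' & E & H). apply pair_inj in E as [-> ->]. exact H.
  - apply finite_class_Union; [unfold P; definability|exact FV|].
    intros y _. apply finite_class_unique.
    intros x x' (Hx & Sx & Kx) (Hx' & Sx' & Kx'). apply colouring_ext; auto.
    intros a i Ha Hi. assert (H : forall b, b ∈ adjoin s e -> b ∈ app x i <-> b ∈ app x' i).
    { intros b Hb. rewrite Kx, Kx' by assumption. tauto. }
    destruct (classic (a ∈ s)) as [Ia|Ia]; [apply H, in_adjoin; auto|].
    rewrite (Sx a e Ha He Ia Ne i Hi), (Sx' a e Ha He Ia Ne i Hi).
    apply H, in_adjoin. auto.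
Qed.

Section Map.

Context (F : M) (hF : is_function F X X).

Lemma map_in x : x ∈ X -> app F x ∈ X.
Proof. intro Hx. apply (function_maps hF Hx). Qed.

Definition recoloured z a b x : Prop := x ∈ X /\ forall i c, i ∈ n -> c ∈ A ->
  (c ∈ app x i <-> (c <> b /\ c ∈ app z i) \/ (c = b /\ a ∈ app z i)).

(** Let [a] and [b] have the same colour in [x], and let [c] be a third fresh point. For
    distinct [p] and [q] let [W p q] be [x] with [p] and [q] given the colour of [a], and
    with the generic colour at the other points among [a] and [b]. So [W p q = W q p] and
    [W a b = x]. Write [T p q] for: [p] lies in the [i]-th component of [F (W p q)]. Since
    [W p q] is obtained from a colouring supported by [adjoin r p] by recolouring the fresh
    point [q], [T p q] does not depend on [q] and [T q p] does not depend on [q] either.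
    Hence [T a b], [T a c], [T b c] and [T b a] are equivalent, which is the claim for
    [i]. *)
Lemma kernel_coarsened : exists e, finite e /\ forall x a b, x ∈ X -> a ∈ A -> b ∈ A ->
  ~ a ∈ e -> ~ b ∈ e -> same_colour x a b -> same_colour (app F x) a b.
Proof.
  set (Y := fun s y => exists z a i, y = pair (pair z a) i /\ z ∈ X /\ supported z s /\
                         a ∈ s /\ i ∈ n).
  assert (dY : definable2 Y) by (unfold Y; definability).
  assert (FY : forall s, finite s -> subset s A -> finite_class (Y s)).
  { intros s Fs _. destruct (finitely_many_supported Fs) as (t & Ft & Ht).
    exists (prod (prod t s) n).
    split; [apply finite_prod; [apply finite_prod|]; assumption|].
    intros y (z & a & i & -> & Hz & Sz & Ha & Hi). rewrite !pair_in_prod. auto. }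
  (* The parameter [y] codes a colouring [z], a point [a] of its support and an index [i];
     [x] is [z] with [b] recoloured. [H1] asks for [a], [H2] for [b] itself. *)
  set (H1 := fun y b => exists z a i x, y = pair (pair z a) i /\ recoloured z a b x /\
                          a ∈ app (app F x) i).
  set (H2 := fun y b => exists z a i x, y = pair (pair z a) i /\ recoloured z a b x /\
                          b ∈ app (app F x) i).
  destruct (@generic_constancy M A hA Y H1) as (e1 & Fe1 & He1);
    [exact dY|unfold H1, recoloured; definability|exact FY|].
  destruct (@generic_constancy M A hA Y H2) as (e2 & Fe2 & He2);
    [exact dY|unfold H2, recoloured; definability|exact FY|].
  apply finite_class_set in Fe1, Fe2. destruct (finite_class_or Fe1 Fe2) as (e & Fe & He).
  exists e. split; [exact Fe|].
  assert (recol_unique : forall z a b x x', recoloured z a b x -> recoloured z a b x' ->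
    x = x').
  { intros z a b x x' [Hx K] [Hx' K']. apply colouring_ext; auto.
    intros c i Hc Hi. rewrite K, K' by assumption. tauto. }
  assert (H1E : forall z a i b x, recoloured z a b x ->
    (H1 (pair (pair z a) i) b <-> a ∈ app (app F x) i)).
  { intros z a i b x Hx. split; [|intro H; exists z, a, i, x; auto].
    intros (z' & a' & i' & x' & E & Hx' & H). apply pair_inj in E as [E ->].
    apply pair_inj in E as [-> ->]. rewrite (recol_unique _ _ _ _ _ Hx Hx'). exact H. }
  assert (H2E : forall z a i b x, recoloured z a b x ->
    (H2 (pair (pair z a) i) b <-> b ∈ app (app F x) i)).
  { intros z a i b x Hx. split; [|intro H; exists z, a, i, x; auto].
    intros (z' & a' & i' & x' & E & Hx' & H). apply pair_inj in E as [E ->].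
    apply pair_inj in E as [-> ->]. rewrite (recol_unique _ _ _ _ _ Hx Hx'). exact H. }
  intros x a b Hx Ha Hb Na Nb Hab i Hi.
  destruct (classic (a = b)) as [->|Nab]; [tauto|].
  destruct (support_exists Hx) as (s & Fs & Ss & Sx).
  destruct (ex_fresh hA (s := adjoin (adjoin (cup s e) a) b)) as (c & Hc & Nc).
  { apply finite_adjoin, finite_adjoin. apply finite_class_set in Fs, Fe. apply finite_class_set.
    refine (finite_class_sub _ (finite_class_or Fs Fe)). intros u Hu. apply in_cup, Hu. }
  rewrite !in_adjoin, in_cup in Nc.
  (* The points in [P] get the colour of [a]; the other points among [a] and [b] get the
     generic colour, which is that of [c]. *)
  set (Q := fun (P : M -> Prop) j d => (P d /\ a ∈ app x j) \/
    (~ P d /\ (d = a \/ d = b) /\ c ∈ app x j) \/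
    (~ P d /\ d <> a /\ d <> b /\ d ∈ app x j)).
  set (w := fun p => colouring (Q (fun d => d = p))).
  set (W := fun p q => colouring (Q (fun d => d = p \/ d = q))).
  assert (Hw : forall p, w p ∈ X /\ forall j d, j ∈ n -> d ∈ A ->
    (d ∈ app (w p) j <-> Q (fun d => d = p) j d)).
  { intro p. apply colouring_spec. unfold Q. definability. }
  assert (HW : forall p q, W p q ∈ X /\ forall j d, j ∈ n -> d ∈ A ->
    (d ∈ app (W p q) j <-> Q (fun d => d = p \/ d = q) j d)).
  { intros p q. apply colouring_spec. unfold Q. definability. }
  clearbody w W.
  assert (Wrec : forall p q, p ∈ A -> recoloured (w p) p q (W p q)).
  { intros p q Hp. split; [apply HW|]. intros j d Hj Hd.
    rewrite (proj2 (HW p q)), !(proj2 (Hw p)) by assumption. unfold Q.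
    destruct (classic (d = q)) as [->|]; tauto. }
  assert (Wsym : forall p q, W p q = W q p).
  { intros p q. apply colouring_ext; [apply HW|apply HW|]. intros d j Hd Hj.
    rewrite (proj2 (HW p q)), (proj2 (HW q p)) by assumption. unfold Q. tauto. }
  assert (Wx : W a b = x).
  { apply colouring_ext; [apply HW|exact Hx|]. intros d j Hd Hj.
    rewrite (proj2 (HW a b)) by assumption. unfold Q. pose proof (Hab j Hj).
    destruct (classic (d = a)) as [->|]; [tauto|].
    destruct (classic (d = b)) as [->|]; tauto. }
  set (r := sep s (fun d => d <> a /\ d <> b)).
  assert (Hr : forall d, d ∈ r <-> d ∈ s /\ d <> a /\ d <> b)
    by (intro d; unfold r; rewrite in_sep by definability; tauto).
  assert (Fr : finite r) by (apply finite_sep; [definability|exact Fs]).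
  assert (sup : forall p, p ∈ A -> supported (w p) (adjoin r p)).
  { intros p Hp d d' Hd Hd' Nd Nd' j Hj.
    assert (G : forall d, d ∈ A -> ~ d ∈ adjoin r p -> d ∈ app (w p) j <-> c ∈ app x j).
    { clear d d' Hd Hd' Nd Nd'. intros d Hd Nd. rewrite in_adjoin, Hr in Nd.
      rewrite (proj2 (Hw p)) by assumption. unfold Q.
      destruct (classic (d = a \/ d = b)) as [Ed|Ed]; [tauto|].
      assert (Nds : ~ d ∈ s) by tauto. assert (Ncs : ~ c ∈ s) by tauto.
      pose proof (Sx d c Hd Hc Nds Ncs j Hj). tauto. }
    rewrite !G by assumption. tauto. }
  assert (step : forall p q q', p ∈ A -> q ∈ A -> q' ∈ A -> q <> p -> q' <> p ->
    ~ q ∈ r -> ~ q' ∈ r -> ~ q ∈ e -> ~ q' ∈ e ->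
    (p ∈ app (app F (W p q)) i <-> p ∈ app (app F (W p q')) i) /\
    (q ∈ app (app F (W p q)) i <-> q' ∈ app (app F (W p q')) i)).
  { intros p q q' Hp Hq Hq' Nqp Nqp' Nqr Nqr' Nqe Nqe'.
    assert (Y0 : Y (adjoin r p) (pair (pair (w p) p) i)).
    { exists (w p), p, i. split; [reflexivity|]. split; [apply Hw|].
      split; [apply sup, Hp|]. split; [apply in_adjoin; auto|exact Hi]. }
    assert (Far : finite (adjoin r p)) by (apply finite_adjoin, Fr).
    assert (Sar : subset (adjoin r p) A).
    { intros d Hd. apply in_adjoin in Hd as [Hd| ->]; [|exact Hp]. apply Hr in Hd.
      apply Ss. tauto. }
    assert (Nq1 : ~ q ∈ adjoin r p) by (rewrite in_adjoin; tauto).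
    assert (Nq1' : ~ q' ∈ adjoin r p) by (rewrite in_adjoin; tauto).
    rewrite <- !(H1E _ _ _ _ _ (Wrec p _ Hp)), <- !(H2E _ _ _ _ _ (Wrec p _ Hp)).
    split; [apply (He1 (adjoin r p))|apply (He2 (adjoin r p))]; auto. }
  assert (Nca : c <> a) by tauto. assert (Ncb : c <> b) by tauto.
  assert (Nce : ~ c ∈ e) by tauto.
  assert (Ra : ~ a ∈ r) by (rewrite Hr; tauto).
  assert (Rb : ~ b ∈ r) by (rewrite Hr; tauto).
  assert (Rc : ~ c ∈ r) by (rewrite Hr; tauto).
  rewrite <- Wx.
  destruct (step a b c) as [S1 _]; auto.
  destruct (step c a b) as [_ S2]; auto.
  destruct (step b c a) as [S3 _]; auto.
  rewrite (Wsym c a), (Wsym c b) in S2. rewrite (Wsym b a) in S3. tauto.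
Qed.

Context (Fsurj : forall y, y ∈ X -> exists x, x ∈ X /\ app F x = y).

Context (e : M) (Fe : finite e)
  (he : forall x a b, x ∈ X -> a ∈ A -> b ∈ A -> ~ a ∈ e -> ~ b ∈ e ->
        same_colour x a b -> same_colour (app F x) a b).

Definition window T : Prop := finite T /\ forall a, a ∈ T -> a ∈ A /\ ~ a ∈ e.

Definition separates x T : Prop := forall a b, a ∈ T -> b ∈ T -> same_colour x a b -> a = b.

Definition same_kernel x y : Prop := forall a b, a ∈ A -> b ∈ A -> ~ a ∈ e -> ~ b ∈ e ->
  (same_colour x a b <-> same_colour y a b).

Definition failing T : Prop := window T /\
  exists x, x ∈ X /\ separates x T /\ ~ separates (app F x) T.

Lemma definable_failing : definable1 failing.
Proof. unfold failing, window, separates. definability. Qed.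
Local Hint Resolve definable_failing : definability.

Lemma definable_same_kernel : definable2 same_kernel.
Proof. unfold same_kernel. definability. Qed.
Local Hint Resolve definable_same_kernel : definability.

(** A set of points with different colours has at most as many elements as there are
    colours. The induction is on the set [W] of admissible colours: at most one point has
    the new colour [c]. *)
Lemma separating_bounded : exists K, level A K /\
  forall x T, x ∈ X -> window T -> separates x T -> T ∈ K.
Proof.
  set (col := fun x a => sep n (fun i => a ∈ app x i)).
  assert (H : forall W, finite W -> exists K, level A K /\ forall x T, x ∈ X -> window T ->
    separates x T -> (forall a, a ∈ T -> col x a ∈ W) -> T ∈ K).
  { apply (finite_ind (P := fun W => exists K, level A K /\ forall x T, x ∈ X -> window T ->
      separates x T -> (forall a, a ∈ T -> col x a ∈ W) -> T ∈ K)).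
    - unfold window, separates, col. definability.
    - exists (adjoin empty empty). split; [apply tower_base|]. intros x T _ _ _ HT.
      apply in_adjoin. right. apply is_emptyE. intros a Ha. exact (in_empty (HT a Ha)).
    - intros W c _ _ (K & HK & IH). exists (enlarge A K).
      split; [apply level_enlarge, HK|]. intros x T Hx [FT WT] ST HT.
      set (T' := sep T (fun a => col x a <> c)).
      assert (HT' : forall a, a ∈ T' <-> a ∈ T /\ col x a <> c)
        by (intro a; unfold T'; rewrite in_sep by (unfold col; definability); tauto).
      assert (KT' : T' ∈ K).
      { apply (IH x); [exact Hx| | |].
        - split; [unfold T'; apply finite_sep; [unfold col; definability|exact FT]|].
          intros a Ha. apply HT' in Ha. apply WT. tauto.
        - intros a b Ha Hb. apply HT' in Ha, Hb. apply ST; tauto.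
        - intros a Ha. apply HT' in Ha as [Ha Na]. apply HT in Ha.
          apply in_adjoin in Ha. tauto. }
      apply in_enlarge; [apply level_sub, HK|].
      destruct (classic (exists a, a ∈ T /\ col x a = c)) as [(a & Ha & Ea)|N].
      + right. exists T', a. split; [exact KT'|]. split; [apply WT, Ha|].
        apply set_ext. intro b. rewrite in_adjoin, HT'. split.
        * intro Hb. destruct (classic (col x b = c)) as [Eb|]; [right|tauto].
          apply (ST b a Hb Ha). intros i Hi.
          assert (E : i ∈ col x b <-> i ∈ col x a) by (rewrite Eb, Ea; tauto).
          unfold col in E. rewrite !in_sep in E by definability. tauto.
        * intros [Hb| ->]; tauto.
      + left. replace T with T'; [exact KT'|]. apply set_ext. intro a. rewrite HT'.
        split; [tauto|]. intro Ha. split; [exact Ha|]. intro Ea. apply N. eauto. }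
  destruct (H (power n) (finite_power hn)) as (K & HK & L). exists K. split; [exact HK|].
  intros x T Hx WT ST. apply (L x T Hx WT ST). intros a _. apply in_power.
  intros i Hi. unfold col in Hi. rewrite in_sep in Hi by definability. tauto.
Qed.

(** Otherwise failing sets could be made larger forever, against [separating_bounded]. *)
Lemma maximal_failing : (exists T, failing T) ->
  exists T, failing T /\ forall T', failing T' -> subset T T' -> T' = T.
Proof.
  intros (T0 & H0). apply NNPP. intro N.
  assert (H : forall K, level A K -> exists T, failing T /\ ~ T ∈ K).
  { apply (level_ind (P := fun K => exists T, failing T /\ ~ T ∈ K)).
    - definability.
    - exists T0. split; [exact H0|]. intro K.
      apply in_adjoin in K as [K| ->]; [exact (in_empty K)|].
      destruct H0 as (_ & x & _ & _ & H). apply H. intros a b Ha. destruct (in_empty Ha).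
    - intros K HK _ (T & HT & NT). apply NNPP. intro N'. apply N. exists T.
      split; [exact HT|]. intros T' HT' S. apply NNPP. intro E. apply N'.
      exists T'. split; [exact HT'|]. intro K'. apply NT.
      apply (level_proper HK K' S). congruence. }
  destruct separating_bounded as (K & HK & L). destruct (H K HK) as (T & HT & NT).
  apply NT. destruct HT as (WT & x & Hx & Sx & _). eauto.
Qed.

(** All these colourings are supported by the support of [x] together with [e]. *)
Lemma same_kernel_finite x : x ∈ X -> finite (sep X (fun u => same_kernel u x)).
Proof.
  intro Hx. destruct (support_exists Hx) as (s & Fs & Ss & Sx).
  assert (Fse : finite (cup s e)).
  { apply finite_class_set in Fs. apply finite_class_set in Fe. apply finite_class_set.
    refine (finite_class_sub _ (finite_class_or Fs Fe)). intros u Hu. apply in_cup, Hu. }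
  apply finite_class_set. refine (finite_class_sub _ (finitely_many_supported Fse)).
  intros u Hu. rewrite in_sep in Hu by definability. destruct Hu as [Hu K].
  split; [exact Hu|]. intros a b Ha Hb Na Nb. rewrite in_cup in Na, Nb.
  apply K; try tauto. apply Sx; tauto.
Qed.

(** Let [T] be a maximal failing set, with witness [x]. If a colouring [u]
    separates [T] and has a colour outside [e] that does not occur on [T], then it separates
    a larger set, which by maximality [F u] separates as well ([extend]). So [T] represents all classes of [x], and
    also all classes of any preimage [u] of a colouring with the kernel of [x]; hence such a
    [u] has the same kernel. By [pigeonhole_total] the finite set [Z] of colourings
    with this kernel is mapped into itself, so [F x] separates [T]. *)
Lemma no_failing T : ~ failing T.
Proof.
  intro HT0. destruct maximal_failing as (T' & (HT & x & Hx & Sx & NSx) & Hmax); [eauto|].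
  clear T HT0. rename T' into T.
  assert (extend : forall u a, u ∈ X -> a ∈ A -> ~ a ∈ e -> separates u T ->
    (forall b, b ∈ T -> ~ same_colour u a b) -> separates (app F u) (adjoin T a)).
  { intros u a Hu Ha Na Su Nb. apply NNPP. intro NS.
    assert (E : adjoin T a = T).
    { apply Hmax; [|intros b Hb; apply in_adjoin; auto]. split.
      - split; [apply finite_adjoin, HT|]. intros b Hb.
        apply in_adjoin in Hb as [Hb| ->]; [apply HT, Hb|auto].
      - exists u. split; [exact Hu|]. split; [|exact NS]. intros b c Hb Hc K.
        apply in_adjoin in Hb as [Hb| ->]; apply in_adjoin in Hc as [Hc| ->]; auto.
        + destruct (Nb b Hb). intros i Hi. symmetry. apply K, Hi.
        + destruct (Nb c Hc K). }
    assert (Ta : a ∈ T) by (rewrite <- E; apply in_adjoin; auto).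
    apply (Nb a Ta). intros i Hi. tauto. }
  assert (full : forall a, a ∈ A -> ~ a ∈ e -> exists b, b ∈ T /\ same_colour x a b).
  { intros a Ha Na. apply NNPP. intro N. apply NSx.
    assert (K : separates (app F x) (adjoin T a)).
    { apply extend; auto. intros b Hb K. apply N. eauto. }
    intros b c Hb Hc. apply K; apply in_adjoin; auto. }
  assert (inwin : forall a, a ∈ T -> a ∈ A /\ ~ a ∈ e) by apply HT.
  set (Z := sep X (fun u => same_kernel u x)).
  assert (HZ : forall u, u ∈ Z <-> u ∈ X /\ same_kernel u x)
    by (intro u; unfold Z; rewrite in_sep by definability; tauto).
  assert (FZ : finite Z) by (apply same_kernel_finite, Hx).
  assert (sep_Z : forall u, u ∈ Z -> separates u T).
  { intros u Hu a b Ha Hb K. apply HZ in Hu as [_ Hu]. apply Sx; auto.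
    destruct (inwin a Ha), (inwin b Hb). apply Hu; auto. }
  destruct (@pigeonhole_total M Z (fun u v => v = app F u)) with (u := x)
    as (z & Hz & E).
  - definability.
  - exact FZ.
  - congruence.
  - intros z Hz. pose proof (sep_Z z Hz) as Sz. apply HZ in Hz as [Xz Kz].
    destruct (Fsurj Xz) as (u & Hu & E). exists u. split; [|auto].
    assert (Su : separates u T).
    { intros a b Ha Hb K. apply Sz; auto. destruct (inwin a Ha), (inwin b Hb).
      rewrite <- E. apply he; auto. }
    assert (full_u : forall a, a ∈ A -> ~ a ∈ e -> exists b, b ∈ T /\ same_colour u a b).
    { intros a Ha Na. apply NNPP. intro N.
      assert (K : separates z (adjoin T a)).
      { rewrite <- E. apply extend; auto. intros b Hb K. apply N. eauto. }
      destruct (full a Ha Na) as (b & Hb & Hab).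
      assert (a = b).
      { apply K; [apply in_adjoin; auto|apply in_adjoin; auto|].
        destruct (inwin b Hb). apply Kz; auto. }
      subst b. apply N. exists a. split; [exact Hb|]. intros i Hi. tauto. }
    apply HZ. split; [exact Hu|]. intros a b Ha Hb Na Nb. rewrite <- (Kz a b) by assumption.
    split; [intro K; rewrite <- E; apply he; auto|]. intro K.
    destruct (full_u a Ha Na) as (a' & Ta & Ka), (full_u b Hb Nb) as (b' & Tb & Kb).
    assert (a' = b').
    { apply Sz; auto. destruct (inwin a' Ta), (inwin b' Tb).
      assert (La : same_colour z a a') by (rewrite <- E; apply he; auto).
      assert (Lb : same_colour z b b') by (rewrite <- E; apply he; auto).
      intros i Hi. rewrite <- (La i Hi), (K i Hi). apply Lb, Hi. }
    subst b'. intros i Hi. rewrite (Ka i Hi), (Kb i Hi). tauto.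
  - apply HZ. split; [exact Hx|]. intros a b _ _ _ _. tauto.
  - apply NSx. rewrite <- E. apply sep_Z, Hz.
Qed.

(** Two points identified by [F x] but not by [x] would form a failing set. *)
Lemma kernel_preserved x : x ∈ X -> same_kernel x (app F x).
Proof.
  intros Hx a b Ha Hb Na Nb. split; [apply he; auto|]. intro K.
  destruct (classic (a = b)) as [->|Nab]; [intros i Hi; tauto|].
  apply NNPP. intro N. apply (@no_failing (upair a b)). split.
  - split.
    + apply finite_class_set. apply (finite_class_sub (Q := fun c => c = a \/ c = b)).
      * intro c. apply in_upair.
      * apply finite_class_or; apply finite_class_one.
    + intros c Hc. apply in_upair in Hc as [-> | ->]; auto.
  - exists x. split; [exact Hx|]. split.
    + intros c d Hc Hd L. apply in_upair in Hc as [-> | ->], Hd as [-> | ->]; auto.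
      * destruct (N L).
      * destruct N. intros i Hi. symmetry. apply L, Hi.
    + intro S. apply Nab. apply S; rewrite ?in_upair; auto.
Qed.

Lemma surjection_injective u v : u ∈ X -> v ∈ X -> app F u = app F v -> u = v.
Proof.
  intros Hu Hv E. set (z := app F u).
  assert (Hz : z ∈ X) by (apply map_in, Hu).
  set (Z := sep X (fun y => same_kernel y z)).
  assert (HZ : forall y, y ∈ Z <-> y ∈ X /\ same_kernel y z)
    by (intro y; unfold Z; rewrite in_sep by definability; tauto).
  apply (@pigeonhole_injective M Z (fun x y => y = app F x)) with (z := z).
  - definability.
  - apply same_kernel_finite, Hz.
  - congruence.
  - intros y Hy. apply HZ in Hy as [Hy Ky]. destruct (Fsurj Hy) as (x & Hx & <-).
    exists x. split; [|reflexivity]. apply HZ. split; [exact Hx|].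
    intros a b Ha Hb Na Nb. rewrite (kernel_preserved Hx Ha Hb Na Nb). apply Ky; auto.
  - apply HZ. split; [exact Hu|apply kernel_preserved, Hu].
  - apply HZ. split; [exact Hv|]. unfold z. rewrite E. apply kernel_preserved, Hv.
  - reflexivity.
  - exact E.
Qed.

End Map.

Lemma colourings_dually_finite : dually_dedekind_finite X.
Proof.
  intros F hF HS. apply (injectiveE hF). pose proof (proj1 (surjectiveE hF) HS) as HS'.
  destruct (kernel_coarsened F) as (e & Fe & He). intros u v Hu Hv.
  apply (surjection_injective hF HS' Fe He Hu Hv).
Qed.

End Colourings.

Section Subset.

Context {M : zf_model}.

Lemma dually_finite_subset (X Y : M) :
  subset X Y -> dually_dedekind_finite Y -> dually_dedekind_finite X.
Proof.
  intros S HY f hf Hs. apply (injectiveE hf). pose proof (proj1 (surjectiveE hf) Hs) as Hs'.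
  set (G := fun x y => (x ∈ X /\ y = app f x) \/ (~ x ∈ X /\ y = x)).
  assert (dG : definable2 G) by (unfold G; definability).
  assert (hg : is_function (graph Y Y G) Y Y).
  { apply graph_function; [exact dG|]. intros x Hx. unfold G.
    destruct (classic (x ∈ X)) as [Xx|Nx].
    - exists (app f x). split; [apply S, (function_maps hf Xx)|]. split; [auto|].
      intros b _ [[_ ->]|[N _]]; [reflexivity|tauto].
    - exists x. split; [exact Hx|]. split; [auto|].
      intros b _ [[H _]|[_ ->]]; [tauto|reflexivity]. }
  assert (val : forall x y, x ∈ Y -> y ∈ Y -> G x y -> app (graph Y Y G) x = y).
  { intros x y Hx Hy H. apply (function_app (a := x) hg). apply pair_in_graph; auto. }
  assert (val_in : forall x, x ∈ X -> app (graph Y Y G) x = app f x).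
  { intros x Hx. apply val; [auto|apply S, (function_maps hf Hx)|]. left. auto. }
  assert (I : injective (graph Y Y G)).
  { apply HY; [exact hg|]. apply (surjectiveE hg). intros y Hy.
    destruct (classic (y ∈ X)) as [Xy|Ny].
    - destruct (Hs' y Xy) as (x & Hx & <-). exists x. auto.
    - exists y. split; [exact Hy|]. apply val; auto. right. auto. }
  rewrite (injectiveE hg) in I. intros a a' Ha Ha' E. apply I; auto.
  rewrite !val_in; assumption.
Qed.

Lemma cartesian_power_exists (B n : M) : exists X, is_cartesian_power X B n.
Proof.
  exists (sep (power (prod n B)) (fun f => is_function f n B)). intro f.
  rewrite in_sep by definability. rewrite in_power. split; [tauto|]. intro H.
  split; [|exact H]. apply is_functionE in H. tauto.
Qed.

End Subset.

Theorem theorem5p3 (M : zf_model) (A n : M)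
  (hA : strictly_amorphous A) (hn : natural n) :
  (exists F X : M,
      is_fin F A /\ is_cartesian_power X F n /\ dually_dedekind_finite X) /\
  (exists P Y : M,
      is_powerset P A /\ is_cartesian_power Y P n /\ dually_dedekind_finite Y).
Proof.
  destruct (cartesian_power_exists (power A) n) as (Y & HY).
  assert (DY : dually_dedekind_finite Y)
    by exact (colourings_dually_finite hA (finite_natural hn) HY).
  split; [|exists (power A), Y; split; [intro x; apply in_power|auto]].
  set (F := sep (power A) (@finite M)).
  assert (HF : is_fin F A).
  { intro x. unfold F. rewrite in_sep by definability. rewrite in_power. tauto. }
  destruct (cartesian_power_exists F n) as (X & HX).
  exists F, X. split; [exact HF|]. split; [exact HX|].
  apply (dually_finite_subset (Y := Y)); [|exact DY].
  intros f Hf. apply HY. apply HX in Hf. apply is_functionE in Hf as [H1 H2].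
  apply is_functionE. split; [|exact H2]. intros p Hp. apply H1 in Hp.
  apply in_prod in Hp as (i & x & Hi & Hx & ->). apply pair_in_prod. split; [exact Hi|].
  apply in_power. apply HF in Hx. tauto.
Qed.
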